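(* Let $D$ be a random variable with values in $\{1,2,\dots\}$, let $p_k=\mathbb P(D=k)$ and $\boldsymbol p=(p_k)_{k\ge1}$, and consider the configuration model whose degrees are i.i.d. copies of $D$. Then, for all $\beta\ge0$ satisfying $\mathbb E[e^{\beta D/2}]<\infty$ and for all $B\in\mathbb R$, the thermodynamic limit of the annealed pressure exists: as $n\to\infty$, $$\psi_n^{\rm an,D}(\beta,B)\longrightarrow\varphi^{\rm an,D}(\beta,B),\qquad \varphi^{\rm an,D}(\beta,B)=\sup_{\boldsymbol q}\big[\varphi^{\rm an,d}(\beta,B;\boldsymbol q)-H(\boldsymbol q\mid\boldsymbol p)\big],$$ where the supremum is over all probability distributions $\boldsymbol q=(q_k)_{k\ge1}$ on $\{1,2,\dots\}$. Further, $$\varphi^{\rm an,D}(\beta,B)>\varphi^{\rm an,d}(\beta,B;\boldsymbol p),$$ where $\varphi^{\rm an,d}(\beta,B;\boldsymbol p)$ is the limiting annealed pressure of the configuration model with a deterministic degree sequence having asymptotic degree distribution $\boldsymbol p$.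
   Context: Configuration model with i.i.d. degrees: let $D_1,\dots,D_n$ be i.i.d. copies of $D$ (if $\sum_iD_i$ is odd, $D_n$ is increased by 1). Given the degrees, attach $D_i$ half-edges to each vertex $i\in[n]=\{1,\dots,n\}$ and pair all half-edges uniformly at random; each pair forms an edge. The result is a random multigraph (self-loops and multiple edges allowed) with edge multiset $E_n$. Ising model: $$Z_n(\beta,B)=\sum_{\sigma\in\{-1,+1\}^n}\exp\Big\{\beta\sum_{(i,j)\in E_n}\sigma_i\sigma_j+B\sum_{i\in[n]}\sigma_i\Big\},$$ where edges are counted with multiplicity and a self-loop at $i$ contributes $\sigma_i\sigma_i=1$. The annealed pressure is $\psi_n^{\rm an,D}(\beta,B)=\frac1n\log\mathbb E[Z_n(\beta,B)]$, where $\mathbb E$ is the expectation over both the degrees and the uniform pairing. Relative entropy: $H(\boldsymbol q\mid\boldsymbol p)=\sum_{i\ge1}q_i\log(q_i/p_i)$, with $0\log 0=0$ and value $+\infty$ if $q_i>0=p_i$ for some $i$. For a probability distribution $\boldsymbol q$ on $\{1,2,\dots\}$ with mean $m(\boldsymbol q)=\sum_kkq_k$ (finite, as is assumed of asymptotic degree distributions in the deterministic-degree model), $\varphi^{\rm an,d}(\beta,B;\boldsymbol q)$ is the limiting annealed pressure of the Ising model on the configuration model with deterministic degrees having asymptotic degree distribution $\boldsymbol q$ (the expectation being only over the uniform pairing), given by $$\varphi^{\rm an,d}(\beta,B;\boldsymbol q)=\frac{\beta m(\boldsymbol q)}2+\sup_{s_k\in(0,1)\,\forall k}\Big\{\sum_{k\ge1}q_kI(s_k)+B\Big(2\sum_{k\ge1}s_kq_k-1\Big)+m(\boldsymbol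 q)F_\beta\Big(\frac{\sum_{k\ge1}kq_ks_k}{m(\boldsymbol q)}\Big)\Big\},$$ where $I(t)=-t\log t-(1-t)\log(1-t)$, $$F_\beta(t)=\int_0^{\min\{t,1-t\}}\log f_\beta(u)\,du,\qquad f_\beta(u)=\frac{e^{-2\beta}(1-2u)+\sqrt{1+(e^{-4\beta}-1)(1-2u)^2}}{2(1-u)}.$$
   Formalization: The strict inequality is stated only for β > 0 and D not almost surely constant: at β = 0 (φ^{an,d}(0,B;q) = log(2cosh B) for all q) or for constant D (H = +∞ unless q = p) equality holds. *)

(* Defs.v *)
From HB Require Import structures.
From mathcomp Require Import all_boot all_order all_algebra.
From mathcomp Require Import finmap.
From mathcomp Require Import all_classical all_reals all_analysis.

Set Implicit Arguments.
Unset Strict Implicit.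
Unset Printing Implicit Defensive.

Import Order.TTheory GRing.Theory Num.Theory.
Import numFieldNormedType.Exports.

Local Open Scope classical_set_scope.
Local Open Scope ring_scope.

Definition half_edge (n : nat) (d : 'I_n -> nat) : finType :=
  {i : 'I_n & 'I_(d i)}.

(* A pairing is a partition of the half-edges into blocks of size two; each
   block is one edge, joining the vertices [tag h] of its two half-edges. So
   self-loops and multiple edges are allowed and counted with multiplicity. *)
Definition pairings (n : nat) (d : 'I_n -> nat) :
    {set {set {set half_edge d}}} :=
  [set M | finset.partition M [set: half_edge d]%SET
           && [forall e in M, #|e : {set half_edge d}| == 2%N]].

(* Vertices are numbered from 0, so the vertex n of [n] is the i with
   i.+1 = n. *)
Definition fix_parity (n : nat) (d : 'I_n -> nat) (i : 'I_n) : nat :=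
  (d i + ((i.+1 == n) && odd (\sum_j d j)))%N.

Section ising.
Context {R : realType}.
Implicit Types (beta B : R).

Definition spin (n : nat) (sigma : {ffun 'I_n -> bool}) (i : 'I_n) : R :=
  if sigma i then 1 else -1.

Definition Ising_Z (n : nat) (d : 'I_n -> nat)
    (M : {set {set half_edge d}}) beta B : R :=
  \sum_(sigma : {ffun 'I_n -> bool})
     expR (beta * (\sum_(e in M) \prod_(h in e) spin sigma (tag h))
           + B * \sum_i spin sigma i).

(* Expectation over the uniform pairing, the degrees being given. *)
Definition pairing_mean_Z (n : nat) (d : 'I_n -> nat) beta B : R :=
  (\sum_(M in pairings d) Ising_Z M beta B) / #|pairings d|%:R.

(* Expectation over the degrees [X 0, ..., X n.-1] and the pairing. *)
Definition annealed_pressure d (Omega : measurableType d)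
    (P : probability Omega R) (X : nat -> {RV P >-> nat}) beta B (n : nat)
    : \bar R :=
  ((n%:R^-1)%:E *
   lne 'E_P[fun w => pairing_mean_Z
                       (fix_parity (fun i : 'I_n => X i w)) beta B])%E.

Definition mutually_independent d (Omega : measurableType d)
    (P : probability Omega R) (X : nat -> {RV P >-> nat}) : Prop :=
  forall (J : {fset nat}) (A : nat -> set nat),
    P (\bigcap_(i in [set` J]) (X i @^-1` A i)) =
    (\prod_(i <- J) P (X i @^-1` A i))%E.

Definition iid_copies d0 (T : measurableType d0) (P0 : probability T R)
    (D : {RV P0 >-> nat}) d (Omega : measurableType d)
    (P : probability Omega R) (X : nat -> {RV P >-> nat}) : Prop :=
  mutually_independent X /\
  forall i (A : set nat), P (X i @^-1` A) = P0 (D @^-1` A).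

Definition degree_law d (T : measurableType d) (P : probability T R)
    (D : {RV P >-> nat}) (k : nat) : R := fine (P [set w | D w = k]).

(* Distributions on {1, 2, ...}, as sequences indexed by nat with no mass at
   0. *)
Definition is_distr (q : nat -> R) : Prop :=
  [/\ q 0%N = 0, forall k, 0 <= q k & (\sum_(1 <= k <oo) (q k)%:E = 1)%E].

Definition finite_mean (q : nat -> R) : Prop :=
  (\sum_(1 <= k <oo) (k%:R * q k)%:E < +oo)%E.

Definition mean (q : nat -> R) : R := \big[+%R/0]_(1 <= k <oo) (k%:R * q k).

(* For distributions q and p the series converges in ]-oo, +oo], because
   q * ln (q / p) >= q - p. *)
Definition relative_entropy (q p : nat -> R) : \bar R :=
  (\sum_(1 <= k <oo)
     if q k == 0%R then 0
     else if p k == 0%R then +oo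
     else (q k * ln (q k / p k))%:E)%E.

Definition binary_entropy (t : R) : R := - t * ln t - (1 - t) * ln (1 - t).

Definition f_ beta (u : R) : R :=
  (expR (- 2 * beta) * (1 - 2 * u)
   + Num.sqrt (1 + (expR (- 4 * beta) - 1) * (1 - 2 * u) ^+ 2))
  / (2 * (1 - u)).

Definition F_ beta (t : R) : R :=
  \int[lebesgue_measure]_(u in `[0, Num.min t (1 - t)]) ln (f_ beta u).

Definition phi_functional beta B (q s : nat -> R) : R :=
  \big[+%R/0]_(1 <= k <oo) (q k * binary_entropy (s k))
  + B * (2 * \big[+%R/0]_(1 <= k <oo) (s k * q k) - 1)
  + mean q * F_ beta
      ((\big[+%R/0]_(1 <= k <oo) (k%:R * q k * s k)) / mean q).

(* Limiting annealed pressure for deterministic degrees; meaningful for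
   distributions q of finite mean. *)
Definition phi_and beta B (q : nat -> R) : \bar R :=
  ((beta * mean q / 2)%:E
   + ereal_sup [set (phi_functional beta B q s)%:E
               | s in [set s : nat -> R | forall k, (0 < s k < 1)%R]])%E.

(* [phi_and] is only defined for distributions of finite mean, so the supremum
   is over those; [phi_and] is then finite, and a q with
   [relative_entropy q p = +oo] contributes -oo. *)
Definition phi_anD beta B (p : nat -> R) : \bar R :=
  ereal_sup [set (phi_and beta B q - relative_entropy q p)%E
            | q in [set q : nat -> R | is_distr q /\ finite_mean q]].

End ising.

(* Main.v *)
Require Import Defs.
From HB Require Import structures.
From mathcomp Require Import all_boot all_order all_algebra.
From mathcomp Require Import finmap.
From mathcomp Require Import all_classical all_reals all_analysis.
From mathcomp Require Import measurable_realfun.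
From mathcomp Require Import ring lra zify.

Set Implicit Arguments.
Unset Strict Implicit.
Unset Printing Implicit Defensive.

Import Order.TTheory GRing.Theory Num.Theory.
Import numFieldNormedType.Exports.

(* Averaged over the pairing, the weight of a spin configuration depends only on
   the numbers a and b of half-edges at + and at - vertices. Up to a constant
   factor it is exp (Psi (a, b)) with
     Psi (a, b) = (a + b) * (beta / 2 + F_ beta (a / (a + b))),
   which is convex and homogeneous of degree one, so Psi is the supremum over
   0 <= x <= 1 of the linear forms a * lamp x + b * lamm x given by its gradients.
   For fixed x the sum over spins factorises over the vertices, and its mean over
   i.i.d. degrees is the n-th power of
     N x = E [exp (B + lamp x * D) + exp (- B + lamm x * D)].
   Finitely many x suffice up to a factor e^(eps n) (all rates stay below beta / 2,
   so that only the assumed moment is needed), and the limit is ln (sup N).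
   Gibbs' variational principle turns ln (N x) into the supremum over q and s;
   Euler's identity for Psi gives one inequality, its convexity the other, with q
   the truncated tilted law. For the deterministic-degree pressure, Jensen's
   inequality loses a uniform amount unless the tilting weight is constant on the
   support of D; as a convex function of the degree which is smaller than sup N at
   degree 0, it cannot be. *)

(** In the upper bound the maximising linear form depends on a / (a + b), hence on spins and
    degrees, so the maximum has to become a finite sum before expectations are taken. Two values of
    x give rates differing by at most the absolute value of [dF x - dF y], so a net for the values
    of the bounded function [dF] serves, whatever its continuity. Rounding a rate up could push it
    past beta / 2, where the moment may be infinite; rounded rates are therefore capped at beta / 2,
    and the loss vanishes by dominated convergence under the assumed moment. Everything else in the
    limit is exact up to factors bounded in n: the pairing weight is within exp (2 beta) of its
    asymptotic form, and the parity correction adds at most one half-edge. Strictness needs sup N to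
    exceed exp B + exp (- B), the weight at degree 0, that is beta / 2 + F (1 / 2) > 0. The integral
    is not evaluated: a direct lower bound makes the balanced pairing weight grow like a power of
    any number below (1 + c) / 2, with c = exp (- 2 beta), and (1 + c) / 2 exceeds the square root
    of c. *)

Local Open Scope ring_scope.

(** * Mean weight of a random pairing *)

Section pairing_weight.
Context {R : realFieldType}.
Variable c : R.

(* The mean of c ^ (number of unlike pairs) over the uniform pairings of a + and
   b - half-edges, by revealing the partner of a + half-edge; it has this meaning,
   and is symmetric in a and b, only when a + b is even. *)
Fixpoint pw (a b : nat) : R :=
  match a with
  | 0%N => 1
  | S a1 =>
    match a1 with
    | 0%N => c
    | S a2 => (a1%:R * pw a2 b + c * b%:R * pw a1 b.-1) / (a1 + b)%:R
    end
  end.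

Arguments pw : simpl never.

Lemma pw0 b : pw 0 b = 1. Proof. by case: b. Qed.
Lemma pw1 b : pw 1 b = c. Proof. by case: b. Qed.

Lemma pwSS a b : (a.+1 + b)%:R * pw a.+2 b
  = a.+1%:R * pw a b + c * b%:R * pw a.+1 b.-1.
Proof.
rewrite [pw a.+2 b]/(((a.+1)%:R * pw a b + c * b%:R * pw a.+1 b.-1) / (a.+1 + b)%:R).
by rewrite mulrC divfK// pnatr_eq0.
Qed.

(** The recursion with its index shifted; at a = 0 or b = 0 the meaningless predecessor carries the
    factor 0. *)
Lemma pwS a b : (0 < a + b)%N -> (a + b)%:R * pw a.+1 b
  = a%:R * pw a.-1 b + c * b%:R * pw a b.-1.
Proof.
case: a => [|a] ab; last by rewrite pwSS.
by rewrite pw1 pw0 mul0r add0r; ring.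
Qed.

(** The recursion that reveals the partner of a - half-edge. Revealing a + and then a - half-edge
    has to agree with the opposite order; the induction makes the rule available with two half-edges
    fewer. *)
Lemma pwSr_aux n a b : (a + b <= n)%N -> odd (a + b) ->
  (a + b)%:R * pw a b.+1 = b%:R * pw a b.-1 + c * a%:R * pw a.-1 b.
Proof.
elim/ltn_ind: n a b => n IH a b abn oab.
case: a abn oab => [|a] abn oab.
  by rewrite !pw0 !mulr0 mul0r addr0 add0n.
case: a abn oab => [|a] abn oab.
  case: b abn oab => [|b] abn oab; first by rewrite !pw1 !pw0 mul0r mulr1 mul1r; ring.
  by rewrite !pw1 !pw0 -natr1 natrD /=; ring.
have E1 := pwSS a b.+1.
case: b abn oab E1 => [|b] abn oab E1.
  case: a abn oab E1 => [|a] abn oab E1; first by lia.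
  have E2 := pwSS a.+1 0.
  have E3 := pwSS a 0.
  have IH1 : _ := IH n.-2 _ a.+1 0 _ _.
  have {}IH1 : (a.+1 + 0)%:R * pw a.+1 1 = 0 * pw a.+1 0 + c * a.+1%:R * pw a 0.
    by apply: IH1; lia.
  move: E1 E2 E3 IH1; rewrite !addn0 !addn1 /=.
  set x := pw a 0; set y := pw a.+1 0; set z := pw a.+2 0; set u := pw a.+3 1.
  rewrite mul0r add0r mulr0 mul0r addr0 => E1 E2 E3 E4.
  have a0 : a.+1%:R != 0 :> R by rewrite pnatr_eq0.
  have x1 : pw a.+1 1 = c * x by apply: (mulfI a0); rewrite E4; ring.
  have x2 : z = x by apply: (mulfI a0); rewrite E3; ring.
  by rewrite E1 x1 x2; ring.
have E2 := pwSS a b.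
have E3 := pwSS a b.+1.
have IHg a' b' : (a' + b' < a.+2 + b.+1)%N -> odd (a' + b') ->
  (a' + b')%:R * pw a' b'.+1 = b'%:R * pw a' b'.-1 + c * a'%:R * pw a'.-1 b'.
  by move=> h o; apply: (IH (a'+b')%N) => //; lia.
have IH1 := IHg a b.+1 ltac:(lia) ltac:(lia).
have IH2 := IHg a.+1 b ltac:(lia) ltac:(lia).
have E4 := @pwS a b.+1 ltac:(lia).
have E5 := pwSS a b.+2.
rewrite /= in E1 E2 E3 E4 E5 IH1 IH2 *.
have d0 : (a + b.+1)%:R != 0 :> R by rewrite pnatr_eq0; lia.
apply: (mulfI d0).
move: E2 E4 E5 IH1 IH2.
set x0 := pw a.-1 b.+1.
set x1 := pw a b.
set x2 := pw a b.+2.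
set x3 := pw a.+1 b.-1.
set x4 := pw a.+1 b.+1.
set x5 := pw a.+2 b.
set x6 := pw a.+2 b.+2.
rewrite !natrD -!natr1 => E2 E4 E5 IH1 IH2.
have X5 : (a%:R + (b%:R + 1)) * x5 = (a%:R + 1) * x1 + c * b%:R * x3.
  by rewrite -E2; ring.
have X6 : (a%:R + 1 + 1 + (b%:R + 1)) * x6 = (a%:R + 1) * x2 + c * (b%:R + 1 + 1) * x4.
  by rewrite -E5; ring.
rewrite X6.
transitivity ((b%:R + 1) * ((a%:R + (b%:R + 1)) * x5)
  + (a%:R + (b%:R + 1)) * (c * (a%:R + 1 + 1) * x4)); last by ring.
rewrite X5.
have X2 : (a%:R + (b%:R + 1)) * x2 = (b%:R + 1) * x1 + c * a%:R * x0 by exact: IH1.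
have X4 : (a%:R + (b%:R + 1)) * x4 = a%:R * x0 + c * (b%:R + 1) * x1 by exact: E4.
(* [X4] expands [x4] from the + side by definition, [X4'] from the - side by induction; one use of
   each closes the computation. *)
have X4' : (a%:R + (b%:R + 1)) * x4 = b%:R * x3 + c * (a%:R + 1) * x1.
  by rewrite -IH2; ring.
transitivity ((a%:R + 1) * ((a%:R + (b%:R + 1)) * x2)
   + c * ((b%:R + 1) - (a%:R + 1)) * ((a%:R + (b%:R + 1)) * x4)
   + (a%:R + (b%:R+1)) * (c * (a%:R + 1 + 1) * x4)); first by ring.
rewrite X2; congr (_ + _).
transitivity ((a%:R + 1) * (b%:R + 1) * x1
  + c * ((a%:R + 1) * a%:R * x0
         + ((b%:R + 1) * ((a%:R + (b%:R + 1)) * x4)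
            - (a%:R + 1) * ((a%:R + (b%:R + 1)) * x4)))); first by ring.
by rewrite {1}X4' X4; ring.
Qed.

Lemma pwSr a b : odd (a + b) ->
  (a + b)%:R * pw a b.+1 = b%:R * pw a b.-1 + c * a%:R * pw a.-1 b.
Proof. exact: pwSr_aux. Qed.

(* Unlike the defining recursion, this one keeps the total a + b fixed. Its fixed
   point equation for the ratio of consecutive weights is solved by f_. *)
Lemma pw_row a b : odd (a + b) -> (0 < a)%N ->
  b.+1%:R * pw a.+1 b = c * (b.+1%:R - a%:R) * pw a b.+1 + a%:R * pw a.-1 b.+2.
Proof.
case: a => // a oab _ /=.
have d0 : (a.+1 + b)%:R != 0 :> R by rewrite pnatr_eq0.
apply: (mulfI d0).
have E1 := @pwS a.+1 b ltac:(lia).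
have E2 := @pwSr a b.+1 ltac:(lia).
have E3 := @pwS a b.+1 ltac:(lia).
have E4 := @pwSr a.+1 b ltac:(lia).
rewrite /= in E1 E2 E3 E4 *.
move: E1 E2 E3 E4.
set x1 := pw a.+2 b.
set x2 := pw a b.
set x3 := pw a.+1 b.-1.
set x4 := pw a b.+2.
set x5 := pw a.-1 b.+1.
set x6 := pw a.+1 b.+1.
rewrite !natrD -!natr1 => E1 E2 E3 E4.
have E2' : (a%:R + 1 + b%:R) * x4 = (b%:R + 1) * x2 + c * a%:R * x5 by rewrite -E2; ring.
have E3' : (a%:R + 1 + b%:R) * x6 = a%:R * x5 + c * (b%:R + 1) * x2 by rewrite -E3; ring.
transitivity ((b%:R + 1) * ((a%:R + 1 + b%:R) * x1)); first by ring.
rewrite E1.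
transitivity (c * (b%:R + 1) * ((a%:R + 1 + b%:R) * x6)
  - c * (a%:R + 1) * ((a%:R + 1 + b%:R) * x6)
  + (a%:R + 1) * ((a%:R + 1 + b%:R) * x4)); last by ring.
by rewrite E2' {1}E4 E3'; ring.
Qed.

Lemma pw_row0 b : ~~ odd b -> pw b 0 = 1.
Proof.
elim/ltn_ind: b => -[|[|b]] IH // ob.
have E := pwSS b 0.
have d0 : b.+1%:R != 0 :> R by rewrite pnatr_eq0.
apply: (mulfI d0).
by rewrite addn0 in E; rewrite E IH// ?mulr0 ?mul0r ?addr0//; lia.
Qed.

(** Exchanging the two kinds of half-edges exchanges the recursions [pwSS] and [pwSr]; the latter
    asks for the parity assumed here. *)
Lemma pwC a b : ~~ odd (a + b) -> pw a b = pw b a.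
Proof.
elim/ltn_ind: a b => -[|a] IH b oab.
  by rewrite pw0 pw_row0.
case: a IH oab => [|a] IH oab.
  case: b oab => [//|[|b]] oab; first by [].
  have E' := @pwSr b.+2 0 ltac:(lia).
  have d0 : b.+2%:R != 0 :> R by rewrite pnatr_eq0.
  apply: (mulfI d0).
  rewrite /= addn0 mul0r add0r in E'.
  rewrite E' pw_row0; last by lia.
  by rewrite pw1; ring.
have d0 : (a.+1 + b)%:R != 0 :> R by rewrite pnatr_eq0.
apply: (mulfI d0).
rewrite pwSS.
have E := @pwSr b a.+1 ltac:(lia).
rewrite addnC E /= (IH a)//; last by lia.
case: b oab {E d0} => [|b] oab; first by rewrite !mulr0 !mul0r.
by rewrite (IH a.+1)//=; lia.
Qed.

End pairing_weight.

(** * Sums over perfect matchings *)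

Section perfect_matchings.
Variable H : finType.
Implicit Types (A e : {set H}) (M : {set {set H}}).

(** Matchings of an arbitrary subset, so that edges can be removed one at a time; [pairings d] is
    the case of all half-edges. *)
Definition pms A : {set {set {set H}}} :=
  [set M | finset.partition M A && [forall e in M, #|e| == 2%N]]%SET.

Lemma pmsP A M : reflect (finset.partition M A /\ {in M, forall e, #|e| = 2%N})
  (M \in pms A).
Proof.
rewrite inE; apply: (iffP andP) => -[pM h]; split=> //.
  by move=> e eM; apply/eqP; exact: (forall_inP h).
by apply/forall_inP => e eM; rewrite h.
Qed.

Lemma pms_set0 : pms finset.set0 = [set finset.set0]%SET.
Proof.
apply/setP => M; rewrite !inE finset.partition_set0.
apply/andP/idP => [[//]|/eqP->]; split=> //.
by apply/forall_inP => e; rewrite inE.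
Qed.

Lemma pmsD1 A M e : M \in pms A -> e \in M -> (M :\ e)%SET \in pms (A :\: e).
Proof.
move=> /pmsP[pM M2] eM; apply/pmsP; split; first exact: finset.partitionD1.
by move=> f /setD1P[_ fM]; exact: M2.
Qed.

Lemma pmsU1 A M e : e \subset A -> #|e| = 2%N -> M \in pms (A :\: e)%SET ->
  (e |: M)%SET \in pms A.
Proof.
move=> eA e2 /pmsP[pM M2]; apply/pmsP; split.
  have <- : (e :|: (A :\: e) = A)%SET.
    by rewrite -[RHS](finset.setID _ e) (finset.setIidPr eA).
  apply: finset.partitionU1 => //; first by rewrite -card_gt0 e2.
  by rewrite -finset.setI_eq0 finset.setIDA finset.setDIl finset.setDv finset.set0I.
by move=> f /setU1P[->//|]; exact: M2.
Qed.

Lemma pms_notin A M e : e != finset.set0 -> M \in pms (A :\: e)%SET -> e \notin M.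
Proof.
move=> e0 /pmsP[pM _]; apply/negP => /(finset.partitionS pM).
rewrite finset.subsetD => /andP[_]; rewrite -finset.setI_eq0 finset.setIid => /eqP e00.
by rewrite e00 eqxx in e0.
Qed.

Definition partner M (h : H) : H := odflt h [pick h' in finset.pblock M h :\ h]%SET.

Lemma partnerE A M h : M \in pms A -> h \in A ->
  [/\ partner M h \in (A :\ h)%SET & [set h; partner M h]%SET \in M].
Proof.
move=> /pmsP[pM M2] hA.
have hc : h \in finset.cover M by rewrite (finset.cover_partition pM).
have bM := finset.pblock_mem hc.
have hb : h \in finset.pblock M h by rewrite finset.mem_pblock.
have := M2 _ bM; rewrite (cardsD1 h) hb add1n => -[/eqP/cards1P[h' Eh']].
have -> : partner M h = h'.
  rewrite /partner; case: pickP => [x|/(_ h')]; rewrite Eh' ?inE; first by move/eqP.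
  by rewrite eqxx.
have h'b : h' \in (finset.pblock M h :\ h)%SET by rewrite Eh' inE.
split; last by rewrite -Eh' finset.setD1K.
move: h'b; rewrite !inE => /andP[-> h'b]/=.
exact: (fintype.subsetP (finset.partitionS pM bM)).
Qed.

Lemma partner_uniq A M h h' : M \in pms A -> h != h' -> [set h; h']%SET \in M ->
  partner M h = h'.
Proof.
move=> /pmsP[pM M2] hh' eM.
have -> : partner M h = odflt h [pick x in [set h; h'] :\ h]%SET.
  by rewrite /partner (finset.def_pblock (finset.partition_trivIset pM) eM)// !inE eqxx.
case: pickP => [x|/(_ h')]; rewrite !inE; last by rewrite eqxx orbT eq_sym hh'.
by case: eqP => //= _ /eqP.
Qed.

(** Matchings are grouped by the partner of h; deleting the edge at h is a bijection from each group
    onto the matchings of the remaining points. *)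
Lemma sum_pms_rec (R : comNzRingType) (w : {set H} -> R) A h : h \in A ->
  \sum_(M in pms A) \prod_(e in M) w e =
  \sum_(h' in (A :\ h)%SET) w [set h; h']%SET *
     \sum_(M in pms (A :\: [set h; h'])%SET) \prod_(e in M) w e.
Proof.
move=> hA.
rewrite (partition_big (partner ^~ h) (fun x => x \in (A :\ h)%SET)) /=; last first.
  by move=> M MA; have [] := partnerE MA hA.
apply: eq_bigr => h' h'A.
have /setD1P[h'h h'A'] := h'A.
set e := [set h; h']%SET.
have e2 : #|e| = 2%N by rewrite cards2 eq_sym h'h.
have eA : e \subset A by apply/fintype.subsetP => x; rewrite !inE => /orP[]/eqP->.
rewrite big_distrr /=.
rewrite (reindex_onto (fun M => e |: M)%SET (fun M => M :\ e)%SET)/=; last first.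
  move=> M /andP[MA /eqP Eh']; have [_] := partnerE MA hA.
  by rewrite Eh' => eM; rewrite finset.setD1K.
have e0 : e != finset.set0 by rewrite -card_gt0 e2.
apply: congr_big => //= M.
  apply/idP/idP.
    move=> /andP[/andP[MA _] /eqP <-].
    by apply: pmsD1 => //; rewrite !inE eqxx.
  move=> MA; have eM := pms_notin e0 MA.
  have MA' := pmsU1 eA e2 MA.
  rewrite MA' /= finset.setU1K// eqxx andbT.
  by apply/eqP/(partner_uniq MA'); rewrite 1?eq_sym// !inE eqxx.
move=> /andP[/andP[MA _] /eqP EM].
by rewrite big_setU1//= -EM !inE eqxx.
Qed.

(** The double factorial (2 N - 1)!!, the number of perfect matchings of 2 N points. *)
Definition dfact (N : nat) : nat := (\prod_(i < N) (2 * i + 1))%N.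

(** After division by the number of matchings, [sum_pms_rec] becomes the recursion of [pw]; the
    factor w0 is collected once per edge. *)
Lemma sum_pms (R : realFieldType) (w : {set H} -> R) (col : pred H) (w0 c : R) :
  (forall h h', h != h' ->
     w [set h; h']%SET = w0 * (if col h == col h' then 1 else c)) ->
  forall N A, #|A| = (2 * N)%N ->
  \sum_(M in pms A) \prod_(e in M) w e =
  w0 ^+ N * (dfact N)%:R *
    pw c #|[set h in A | col h]%SET| #|[set h in A | ~~ col h]%SET|.
Proof.
move=> Hw; elim=> [|N IH] A AN.
  move/eqP: AN; rewrite muln0 cards_eq0 => /eqP->.
  rewrite pms_set0 big_set1 big_set0 expr0 mul1r /dfact big_ord0 mul1r.
  have -> : [set h in finset.set0 | col h]%SET = finset.set0 :> {set H}.
    by apply/setP => x; rewrite !inE.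
  by rewrite cards0 pw0.
have cardD A' :
    #|A'| = (#|[set h in A' | col h]%SET| + #|[set h in A' | ~~ col h]%SET|)%N.
  rewrite -(cardsID [set h | col h]%SET A').
  by congr (_ + _)%N; apply: eq_card => x; rewrite !inE// andbC.
(* [pw] reveals a + half-edge, so h is one whenever there is any; otherwise every pair is alike and
   all weights are 1. *)
have [h hA hcol] : exists2 h, h \in A &
    (~~ col h -> [set h in A | col h]%SET = finset.set0).
  have [E0|[h]] := set_0Vmem [set h in A | col h]%SET.
    have /card_gt0P[h hA] : (0 < #|A|)%N by rewrite AN; lia.
    by exists h.
  by rewrite !inE => /andP[hA hc]; exists h => //; rewrite hc.
rewrite (sum_pms_rec _ hA).
have card2 h' : h' \in (A :\ h)%SET -> #|(A :\: [set h; h'])%SET| = (2 * N)%N.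
  move=> /setD1P[h'h h'A].
  have := cardsID [set h; h']%SET A; rewrite AN (finset.setIidPr _).
    by rewrite cards2 eq_sym h'h; lia.
  by apply/fintype.subsetP => x; rewrite !inE => /orP[]/eqP->.
have cnt (p : pred H) h' : h' \in (A :\ h)%SET ->
    #|[set x in (A :\: [set h; h'])%SET | p x]%SET| =
    (#|[set x in A | p x]%SET| - p h - p h')%N.
  move=> /setD1P[h'h h'A].
  have -> : [set x in (A :\: [set h; h'])%SET | p x]%SET =
      (([set x in A | p x] :\ h) :\ h')%SET.
    apply/setP => x; rewrite !inE negb_or.
    by case: (x == h); case: (x == h') => //=; rewrite ?andbF.
  have := cardsD1 h [set x in A | p x]%SET.
  have := cardsD1 h' ([set x in A | p x] :\ h)%SET.
  rewrite !inE h'h hA h'A /=; lia.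
under eq_bigr => h' h'A.
  rewrite (IH _ (card2 _ h'A)) !cnt// Hw; last by rewrite eq_sym; case/setD1P: h'A.
  over.
set a := #|[set h in A | col h]%SET|; set b := #|[set h in A | ~~ col h]%SET|.
have abN : (a + b = 2 * N.+1)%N by rewrite -AN cardD.
have dS : dfact N.+1 = (dfact N * (2 * N + 1))%N by rewrite /dfact big_ord_recr.
case/boolP: (col h) hcol => [hc _|hc /(_ isT) E0] /=; last first.
  have a0 : a = 0%N by rewrite /a E0 cards0.
  rewrite (eq_bigr (fun=> w0 * (w0 ^+ N * (dfact N)%:R))); last first.
    move=> h' /setD1P[_ h'A].
    have -> : col h' = false.
      by apply/negP => h'c; have := finset.in_set0 h'; rewrite -E0 !inE h'A h'c.
    by rewrite mulr1 a0 !pw0 mulr1.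
  rewrite sumr_const (_ : #|(A :\ h)%SET| = (2 * N + 1)%N); last first.
    by have := cardsD1 h A; rewrite hA AN; lia.
  by rewrite a0 pw0 mulr1 dS natrM exprS -[LHS]mulr_natr; ring.
rewrite (bigID col)/=.
have cA1 : #|[set x in (A :\ h)%SET | col x]%SET| = a.-1.
  have := cardsD1 h [set x in A | col x]%SET; rewrite !inE hA hc /= -/a.
  have -> : ([set x in A | col x] :\ h = [set x in (A :\ h) | col x])%SET.
    by apply/setP => x; rewrite !inE andbA.
  lia.
have cA2 : #|[set x in (A :\ h)%SET | ~~ col x]%SET| = b.
  apply: eq_card => x; rewrite !inE; case: (x =P h) => // ->.
  by rewrite hc !andbF.
have a_gt0 : (0 < a)%N by apply/card_gt0P; exists h; rewrite inE hA hc.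
rewrite (eq_bigr (fun=> w0 * (w0 ^+ N * (dfact N)%:R * pw c a.-2 b))); last first.
  by move=> h' /andP[_ h'c]; rewrite h'c eqxx mulr1 !subn0 !subn1.
rewrite [X in _ + X](eq_bigr (fun=>
  w0 * c * (w0 ^+ N * (dfact N)%:R * pw c a.-1 b.-1))); last first.
  by move=> h' /andP[_ /negbTE h'c]; rewrite h'c !subn0 !subn1.
rewrite !sumr_const.
have -> : #|[pred x in (A :\ h)%SET | col x]| = a.-1.
  by rewrite -cA1; apply: eq_card => x; rewrite !inE.
have -> : #|[pred x in (A :\ h)%SET | ~~ col x]| = b.
  by rewrite -cA2; apply: eq_card => x; rewrite !inE.
have := @pwS _ c a.-1 b ltac:(lia).
rewrite prednK// (_ : (a.-1 + b = 2 * N + 1)%N); last by lia.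
move=> E; rewrite dS natrM exprS -[X in X + _]mulr_natr -[X in _ + X]mulr_natr.
transitivity (w0 * w0 ^+ N * (dfact N)%:R * ((2 * N + 1)%:R * pw c a b)); last by ring.
by rewrite E; ring.
Qed.

End perfect_matchings.

(** * The mean partition function for given degrees *)

Section pairing_mean.
Context {R : realType}.
Variables (n : nat) (d : 'I_n -> nat).

Lemma pairingsE : pairings d = pms [set: half_edge d]%SET.
Proof. by []. Qed.

Lemma card_half_edges (s : pred 'I_n) :
  #|[set h in [set: half_edge d] | s (tag h)]%SET| = (\sum_(i | s i) d i)%N.
Proof.
rewrite -sum1_card.
rewrite (eq_bigl (fun h : half_edge d => s (tag h) && true)); last first.
  by move=> h; rewrite !inE andbT.
rewrite -(sig_big_dep s (fun _ _ => true) (fun i (_ : 'I_(d i)) => 1%N)).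
by apply: eq_bigr => i _; rewrite sum1_card card_ord.
Qed.

Lemma card_half_edge : #|[set: half_edge d]%SET| = (\sum_i d i)%N.
Proof.
by rewrite -(card_half_edges xpredT); apply: eq_card => h; rewrite !inE.
Qed.

(** [sum_pms] with all weights 1 counts the pairings; with every half-edge coloured + the factor
    [pw] is 1. *)
Lemma card_pairings N : (\sum_i d i = 2 * N)%N -> #|pairings d| = dfact N.
Proof.
move=> dN; have := @sum_pms (half_edge d) R (fun=> 1) xpredT 1 1.
move=> /(_ (fun _ _ _ => esym (mul1r 1)) N [set: half_edge d]%SET).
rewrite card_half_edge dN => /(_ erefl).
under eq_bigr do rewrite big1_eq.
rewrite sumr_const expr1n mul1r.
set x := pw _ _ _; suff -> : x = 1.
  by rewrite mulr1 => /eqP; rewrite eqr_nat => /eqP.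
rewrite /x (card_half_edges xpredT) (card_half_edges xpred0) big_pred0_eq.
by rewrite pw_row0//; rewrite dN mul2n odd_double.
Qed.

Lemma dfact_gt0 N : (0 < dfact N)%N.
Proof. by rewrite prodn_gt0// => i; rewrite addn1. Qed.

(** A like edge weighs exp beta and an unlike one exp (- beta) = exp beta * c, hence the parameter c
    = exp (- 2 beta). A self-loop joins two distinct half-edges with equal spin, so it counts as
    like. *)
Lemma pairing_mean_ZE (beta B : R) N : (\sum_i d i = 2 * N)%N ->
  pairing_mean_Z d beta B =
  \sum_(sigma : {ffun 'I_n -> bool}) expR (B * \sum_i spin sigma i) *
    (expR (beta * N%:R) * pw (expR (- 2 * beta))
      (\sum_(i | sigma i) d i) (\sum_(i | ~~ sigma i) d i)).
Proof.
move=> dN; rewrite /pairing_mean_Z /Ising_Z exchange_big/= big_distrl/=.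
apply: eq_bigr => sigma _.
under eq_bigr do rewrite expRD.
rewrite -big_distrl/= [X in X / _]mulrC -mulrA; congr (_ * _).
rewrite (card_pairings dN).
have df0 : (dfact N)%:R != 0 :> R by rewrite pnatr_eq0 -lt0n dfact_gt0.
pose w (e : {set half_edge d}) : R := expR (beta * \prod_(h in e) spin sigma (tag h)).
rewrite (eq_bigr (fun M : {set {set half_edge d}} => \prod_(e in M) w e)); last first.
  by move=> M _; rewrite big_distrr/= expR_sum.
rewrite pairingsE
  (@sum_pms _ _ w (fun h => sigma (tag h)) (expR beta) (expR (- 2 * beta)) _ N);
  last 2 first.
- move=> h h' hh'; rewrite /w big_setU1 ?inE//= big_set1 /spin.
  case: (sigma (tag h)); case: (sigma (tag h')) => /=;
    rewrite ?(mulr1, mul1r, mulrN1, opprK)// -expRD; by congr expR; ring.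
- by rewrite card_half_edge.
rewrite (card_half_edges (fun i => sigma i)) (card_half_edges (fun i => ~~ sigma i)).
by rewrite -expRM_natr; field.
Qed.

End pairing_mean.

(** * The limiting ratio and its integral *)

Local Open Scope classical_set_scope.

Section limiting_ratio.
Context {R : realType}.
Variable beta : R.
Hypothesis beta_ge0 : 0 <= beta.

Local Notation c := (expR (- 2 * beta)).
Local Notation f := (f_ beta).
Local Notation F := (F_ beta).

Let c_gt0 : 0 < c. Proof. exact: expR_gt0. Qed.

Let c_le1 : c <= 1.
Proof. by rewrite -[leRHS]expR0 ler_expR mulNr oppr_le0 mulr_ge0. Qed.

Let c2E : expR (- 4 * beta) = c ^+ 2.
Proof. by rewrite -expRM_natr; congr expR; ring. Qed.

Let root_arg_ge (u : R) : 0 <= u <= 1 -> c ^+ 2 <= 1 + (c ^+ 2 - 1) * (1 - 2 * u) ^+ 2.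
Proof.
move=> u01.
have : 0 <= (1 - c ^+ 2) * (1 - (1 - 2 * u) ^+ 2).
  by apply: mulr_ge0; [rewrite subr_ge0 exprn_ile1// ltW | nra].
lra.
Qed.

(** The limit of [pw_row] divided by a + b, with u = a / (a + b) and all ratios of consecutive
    weights set equal to f u. *)
Lemma f_quadratic (u : R) : 0 <= u < 1 -> (1 - u) * f u ^+ 2 = c * (1 - 2 * u) * f u + u.
Proof.
move=> u01; rewrite /f_ c2E.
set S := Num.sqrt _.
have S2 : S ^+ 2 = 1 + (c ^+ 2 - 1) * (1 - 2 * u) ^+ 2.
  by rewrite sqr_sqrtr// (le_trans _ (root_arg_ge _)) ?sqr_ge0//; lra.
have u1 : 1 - u != 0 by apply/eqP; lra.
have -> : (1 - u) * ((c * (1 - 2 * u) + S) / (2 * (1 - u))) ^+ 2 =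
  (c ^+ 2 * (1 - 2 * u) ^+ 2 + 2 * c * (1 - 2 * u) * S + S ^+ 2) / (4 * (1 - u)).
  by field.
by rewrite S2; field.
Qed.

Lemma f_gt0 (u : R) : 0 <= u <= 1 / 2 -> 0 < f u.
Proof.
move=> u01; rewrite /f_ c2E divr_gt0//; last by lra.
apply: ltr_wpDl; first by apply: mulr_ge0; [exact: ltW|lra].
by rewrite sqrtr_gt0 (lt_le_trans _ (root_arg_ge _))// ?exprn_gt0//; lra.
Qed.

Lemma f0 : f 0 = c.
Proof.
rewrite /f_ c2E !mulr0 !subr0 !mulr1 expr1n mulr1 addrC.
have -> : 1 + (c ^+ 2 - 1) = c ^+ 2 by ring.
by rewrite sqrtr_sqr ger0_norm ?(ltW c_gt0)//; field.
Qed.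

Lemma f_half : f (1 / 2) = 1.
Proof.
rewrite /f_; have -> : 1 - 2 * (1 / 2) = 0 :> R by field.
by rewrite expr0n/= !mulr0 addr0 add0r sqrtr1; field.
Qed.

(* At v the quadratic whose positive root is f v is nonpositive at f u. *)
Lemma f_le (u v : R) : 0 <= u -> u <= v -> v <= 1 / 2 -> f u <= f v.
Proof.
move=> u0 uv v2.
have fu0 : 0 < f u by apply: f_gt0; lra.
have fv0 : 0 < f v by apply: f_gt0; lra.
have Eu := @f_quadratic u ltac:(lra).
have Ev := @f_quadratic v ltac:(lra).
rewrite leNgt; apply/negP => vu0; have vu : f v < f u := vu0.
have Pu : (1 - v) * f u ^+ 2 <= c * (1 - 2 * v) * f u + v.
  have : 0 <= (v - u) * (f u ^+ 2 - 2 * c * f u + 1).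
    apply: mulr_ge0; first by lra.
    have : 0 <= (f u - 1) ^+ 2 + 2 * (1 - c) * f u.
      by rewrite addr_ge0 ?sqr_ge0// mulr_ge0 ?(ltW fu0)// mulr_ge0// subr_ge0 c_le1.
    by lra.
  lra.
have A1 : (1 - v) * f u * f v <= c * (1 - 2 * v) * f v + v * (f v / f u).
  have : (1 - v) * f u ^+ 2 * (f v / f u) <= (c * (1 - 2 * v) * f u + v) * (f v / f u).
    by rewrite ler_wpM2r// divr_ge0// ltW.
  have -> : (1 - v) * f u ^+ 2 * (f v / f u) = (1 - v) * f u * f v by field; rewrite gt_eqF.
  suff -> : (c * (1 - 2 * v) * f u + v) * (f v / f u) =
    c * (1 - 2 * v) * f v + v * (f v / f u) by [].
  by field; rewrite gt_eqF.
have A2 : f v / f u < 1 by rewrite ltr_pdivrMr// mul1r.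
have : 0 < (1 - v) * f v * (f u - f v).
  by rewrite mulr_gt0 ?subr_gt0// mulr_gt0//; lra.
have : v * (f v / f u) <= v * 1 by rewrite ler_wpM2l ?(ltW A2)//; lra.
lra.
Qed.

Lemma f_le1 (u : R) : 0 <= u <= 1 / 2 -> f u <= 1.
Proof. by move=> u01; rewrite -f_half f_le//; lra. Qed.

Lemma f_gec (u : R) : 0 <= u <= 1 / 2 -> c <= f u.
Proof. by move=> u01; rewrite -f0 f_le//; lra. Qed.

Lemma ln_f_le0 (u : R) : 0 <= u <= 1 / 2 -> ln (f u) <= 0.
Proof. by move=> u01; rewrite ln_le0// f_le1. Qed.

Lemma ln_f_ge (u : R) : 0 <= u <= 1 / 2 -> - 2 * beta <= ln (f u).
Proof. by move=> u01; rewrite -ler_expR lnK ?posrE ?f_gt0// f_gec. Qed.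

Lemma ln_f_le (u v : R) : 0 <= u -> u <= v -> v <= 1 / 2 -> ln (f u) <= ln (f v).
Proof. by move=> u0 uv v2; rewrite ler_ln ?posrE ?f_gt0 ?f_le//; lra. Qed.

Lemma ln_f_half : ln (f (1 / 2)) = 0.
Proof. by rewrite f_half ln1. Qed.

Lemma ln_f_integrable (t : R) : t <= 1 / 2 ->
  lebesgue_measure.-integrable `[0, t]%classic (EFin \o (fun u => ln (f u))).
Proof.
move=> t2; apply: continuous_compact_integrable; first exact: segment_compact.
apply: continuous_in_subspaceT => u; rewrite inE/= in_itv/= => u0t.
have fu0 : 0 < f u by apply: f_gt0; lra.
have cf : {for u, continuous (f : R -> R)}.
  rewrite /f_ /prop_for/=.
  have cl : {for u, continuous (fun u : R => 1 - 2 * u)}.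
    apply: cvgB; first exact: cvg_cst.
    by apply: cvgM; [exact: cvg_cst|exact: cvg_id].
  apply: cvgM; first apply: cvgD.
  - by apply: cvgM; [exact: cvg_cst|exact: cl].
  - apply: continuous_cvg; first exact: sqrt_continuous.
    apply: cvgD; first exact: cvg_cst.
    apply: cvgM; first exact: cvg_cst.
    by rewrite expr2; apply: cvgM; exact: cl.
  - apply: cvgV; first by rewrite mulf_neq0//; lra.
    apply: cvgM; first exact: cvg_cst.
    by apply: cvgB; [exact: cvg_cst|exact: cvg_id].
by apply: continuous_comp => //; exact: continuous_ln.
Qed.

Lemma F_half_itv (t : R) : t <= 1 / 2 ->
  F t = \int[lebesgue_measure]_(u in `[0, t]%classic) ln (f u).
Proof. by move=> t2; rewrite /F_ min_l//; lra. Qed.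

Lemma F_sym (t : R) : F (1 - t) = F t.
Proof. by rewrite /F_ subKr minC. Qed.

Lemma F0 : F 0 = 0.
Proof. by rewrite F_half_itv ?divr_ge0// set_itv1 Rintegral_set1. Qed.

(** Since [ln f] is nondecreasing on [0, 1 / 2], its integral lies between two rectangles. This
    stands in for differentiating F. *)
Lemma F_increment (u v : R) : 0 <= u -> u <= v -> v <= 1 / 2 ->
  ln (f u) * (v - u) <= F v - F u <= ln (f v) * (v - u).
Proof.
move=> u0 uv v2; rewrite !F_half_itv//; last by lra.
rewrite (@Rintegral_itvB _ (fun u => ln (f u)) (BLeft 0) (BRight v) u)//;
  last exact: ln_f_integrable.
have leb : fine (lebesgue_measure `]u, v]%classic) = v - u.
  rewrite lebesgue_measure_itv/= lte_fin; case: (ltP u v) => [//|vu].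
  have -> : u = v by apply/le_anti; rewrite uv vu.
  by rewrite subrr.
have sub : `]u, v]%classic `<=` `[0, v]%classic.
  by move=> x; rewrite /= !in_itv/=; lra.
have ic r : lebesgue_measure.-integrable `]u, v]%classic (EFin \o (fun _ : R => r)).
  have H : lebesgue_measure.-integrable `[0, v]%classic (EFin \o (fun _ : R => r)).
    apply: continuous_compact_integrable; first exact: segment_compact.
    by apply: continuous_subspaceT => x; exact: cvg_cst.
  by apply: integrableS H.
have il : lebesgue_measure.-integrable `]u, v]%classic (EFin \o (fun u => ln (f u))).
  by apply: integrableS (ln_f_integrable v2).
apply/andP; split.
  rewrite -[leLHS](_ : \int[lebesgue_measure]_(x in `]u, v]%classic) ln (f u) = _); last first.
    by rewrite Rintegral_cst// leb.
  apply: le_Rintegral => // x; rewrite /= in_itv/= => xuv.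
  by apply: ln_f_le; lra.
rewrite -[leRHS](_ : \int[lebesgue_measure]_(x in `]u, v]%classic) ln (f v) = _); last first.
  by rewrite Rintegral_cst// leb.
apply: le_Rintegral => // x; rewrite /= in_itv/= => xuv.
by apply: ln_f_le; lra.
Qed.

(* The derivative of F on [0, 1]; past 1 / 2 it comes from F (1 - x) = F x. *)
Definition dF (x : R) : R := if x <= 1 / 2 then ln (f x) else - ln (f (1 - x)).

Lemma dF_sym (x : R) : dF (1 - x) = - dF x.
Proof.
rewrite /dF; have [x2|x2] := leP x (1 / 2).
  have [x2'|x2'] := leP (1 - x) (1 / 2); last by rewrite subKr.
  have -> : x = 1 / 2 by lra.
  by rewrite (_ : 1 - 1 / 2 = 1 / 2) ?ln_f_half ?oppr0//; lra.
by rewrite ifT ?opprK//; lra.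
Qed.

Lemma dF_bounds (x : R) : 0 <= x <= 1 -> - 2 * beta <= dF x <= 2 * beta.
Proof.
move=> x01; have b0 := beta_ge0; rewrite /dF; case: (leP x (1 / 2)) => x2.
  have := @ln_f_ge x ltac:(lra); have := @ln_f_le0 x ltac:(lra); lra.
have := @ln_f_ge (1 - x) ltac:(lra); have := @ln_f_le0 (1 - x) ltac:(lra); lra.
Qed.

(** Convexity of F on [0, 1] in tangent form: the slope [dF] increases on the left half, vanishes at
    1 / 2, and is reflected with opposite sign on the right half. *)
Lemma F_support (x y : R) : 0 <= x <= 1 -> 0 <= y <= 1 -> F x + dF x * (y - x) <= F y.
Proof.
wlog x2 : x y / x <= 1 / 2.
  move=> wlg x01 y01; have [x2|x2] := leP x (1 / 2); first exact: wlg.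
  have := wlg (1 - x) (1 - y) ltac:(lra) ltac:(lra) ltac:(lra).
  by rewrite !F_sym dF_sym; lra.
move=> x01 y01.
(* Reflecting y > 1 / 2 to 1 - y keeps F and, the slope at x being nonpositive, can only raise the
   left-hand side. *)
wlog y2 : y y01 / y <= 1 / 2.
  move=> wlg; have [y2|y2] := leP y (1 / 2); first exact: wlg.
  have := wlg (1 - y) ltac:(lra) ltac:(lra); rewrite F_sym.
  apply: le_trans; rewrite lerD2l.
  rewrite ler_wnM2l//; last lra.
  by rewrite /dF x2 ln_f_le0//; lra.
rewrite /dF x2; have [xy|yx] := leP x y.
  have /andP[] := @F_increment x y ltac:(lra) xy y2; lra.
have /andP[] := @F_increment y x ltac:(lra) (ltW yx) x2; lra.
Qed.

End limiting_ratio.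

(** * Uniform asymptotics of the pairing weight *)

Section pairing_asymptotics.
Context {R : realType}.
Variable beta : R.
Hypothesis beta_ge0 : 0 <= beta.

Local Notation c := (expR (- 2 * beta)).
Local Notation f := (f_ beta).
Local Notation F := (F_ beta).
Local Notation dF := (dF beta).


Lemma ratio_half (l n : nat) : (2 * n <= l)%N -> 0 <= (n%:R / l%:R : R) <= 1 / 2.
Proof.
move=> nl; rewrite divr_ge0//=.
case: l nl => [|l] nl; first by rewrite invr0 mulr0.
rewrite ler_pdivrMr ?ltr0n//.
have : (2 * n)%:R <= l.+1%:R :> R by rewrite ler_nat.
by rewrite natrM; lra.
Qed.

Lemma ratio_le (l m n : nat) : (m <= n)%N -> m%:R / l%:R <= n%:R / l%:R :> R.
Proof. by move=> mn; rewrite ler_wpM2r ?invr_ge0// ler_nat. Qed.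

(** The predicted value of [pw] at (n, l - n): limiting ratios multiplied along the row of total l,
    from the exact value 1 at n = 0. *)
Definition ratio_prod (l n : nat) : R := \prod_(j < n) f (j%:R / l%:R).
Local Notation Q := ratio_prod.

Lemma ratio_prodS l n : Q l n.+1 = Q l n * f (n%:R / l%:R).
Proof. by rewrite /ratio_prod big_ord_recr. Qed.

Lemma ratio_prod_gt0 l n : (2 * n <= l)%N -> 0 < Q l n.
Proof.
move=> nl; rewrite /ratio_prod prodr_gt0// => j _; apply: (f_gt0 beta_ge0); apply: ratio_half.
have := ltn_ord j; lia.
Qed.

(* With f_n := f (n / l), the ratio pw / Q at n + 1 is a convex combination of
   the one at n and f_n / f_(n - 1) times the one at n - 1. *)
Lemma pw_prod_bounds l n : ~~ odd l -> (0 < l)%N -> (2 * n <= l)%N ->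
  Q l n <= pw c n (l - n) /\ c * pw c n (l - n) <= f (n%:R / l%:R) * Q l n.
Proof.
move=> ol l0; elim/ltn_ind: n => -[|[|n]] IH nl.
- by rewrite /ratio_prod big_ord0 pw0 !mulr1 mul0r (f0 beta).
- rewrite /ratio_prod big_ord1 pw1 mul0r (f0 beta); split=> //.
  rewrite ler_wpM2r ?expR_ge0// (f_gec beta_ge0)//.
  exact: (@ratio_half l 1).
have n1l : (2 * n.+1 <= l)%N by lia.
have n0l : (2 * n <= l)%N by lia.
have [IHa1 IHa2] := IH n.+1 (ltnSn _) n1l.
have [IHb1 IHb2] := IH n (leqW (ltnSn _)) n0l.
have nlt : (n.+1 < l)%N by lia.
have lN : 0 < (l - n.+1)%:R :> R by rewrite ltr0n subn_gt0.
have [e2 e1] : (l - n.+2).+2 = (l - n)%N /\ (l - n.+2).+1 = (l - n.+1)%N by split; lia.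
have orow : odd (n.+1 + (l - n.+2)) by lia.
have E := pw_row c orow (ltn0Sn n).
rewrite e2 e1 /= in E.
have d0 : 0 <= c * ((l - n.+1)%:R - n.+1%:R).
  by rewrite mulr_ge0 ?expR_ge0// subr_ge0 ler_nat; lia.
have Qn := ratio_prod_gt0 n0l.
have Qn1 := ratio_prod_gt0 n1l.
have Qn2 := ratio_prod_gt0 nl.
have fnr : f (n%:R / l%:R) <= f (n.+1%:R / l%:R).
  apply: (f_le beta_ge0); [|exact: ratio_le|].
    by have /andP[] := ratio_half n0l.
  by have /andP[] := ratio_half n1l.
have fr2 : f (n.+1%:R / l%:R) <= f (n.+2%:R / l%:R).
  apply: (f_le beta_ge0); [|exact: ratio_le|].
    by have /andP[] := ratio_half n1l.
  by have /andP[] := ratio_half nl.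
have r12 := ratio_half n1l.
have QSn : Q l n.+1 = Q l n * f (n%:R / l%:R) by rewrite ratio_prodS.
have Q2E : Q l n.+2 = Q l n.+1 * f (n.+1%:R / l%:R) by rewrite ratio_prodS.
have lr : l%:R * (n.+1%:R / l%:R) = n.+1%:R :> R.
  by rewrite mulrCA divff ?mulr1// pnatr_eq0 -lt0n.
set r : R := n.+1%:R / l%:R in r12 lr fnr fr2 Q2E IHa2 *.
have fr := f_gt0 beta_ge0 r12.
have r01 : 0 <= r < 1 by clear -r12; lra.
have lNE : (l - n.+1)%:R = l%:R * (1 - r) :> R.
  by rewrite natrB 1?ltnW// -lr; ring.
have quad := f_quadratic beta_ge0 r01.
have cdE : c * ((l - n.+1)%:R - n.+1%:R) = l%:R * (c * (1 - 2 * r)).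
  by rewrite lNE -lr; ring.
split.
  rewrite -(ler_pM2l lN) E.
  have H1 : c * ((l - n.+1)%:R - n.+1%:R) * Q l n.+1 + n.+1%:R * Q l n <=
     c * ((l - n.+1)%:R - n.+1%:R) * pw c n.+1 (l - n.+1) + n.+1%:R * pw c n (l - n).
    by rewrite lerD// ler_wpM2l.
  (* The factor [f r] produces [f r ^+ 2], which [quad] makes linear; what remains is the
     monotonicity of f, used in [H2]. *)
  apply: le_trans H1; rewrite -(ler_pM2r fr).
  have H2 : n.+1%:R * Q l n.+1 <= n.+1%:R * Q l n * f r.
    by rewrite QSn -mulrA ler_wpM2l// ler_wpM2l// ltW.
  have -> : (l - n.+1)%:R * Q l n.+2 * f r = (l%:R * Q l n.+1) * ((1 - r) * f r ^+ 2).
    by rewrite lNE Q2E; ring.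
  rewrite quad [leRHS]mulrDl cdE.
  have -> : l%:R * Q l n.+1 * (c * (1 - 2 * r) * f r + r) =
    l%:R * (c * (1 - 2 * r)) * Q l n.+1 * f r + (l%:R * r) * Q l n.+1 by ring.
  by rewrite lr lerD2l.
apply: (@le_trans _ _ (f r * Q l n.+2)); last by rewrite ler_wpM2r// ltW.
rewrite -(ler_pM2l lN) mulrCA E.
have -> : (l - n.+1)%:R * (f r * Q l n.+2) = l%:R * Q l n.+1 * ((1 - r) * f r ^+ 2).
  by rewrite lNE Q2E; ring.
rewrite quad.
have -> : l%:R * Q l n.+1 * (c * (1 - 2 * r) * f r + r) =
  c * ((l - n.+1)%:R - n.+1%:R) * (f r * Q l n.+1) + n.+1%:R * Q l n.+1.
  by rewrite cdE -lr; ring.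
rewrite mulrDr lerD//.
  by rewrite mulrCA ler_wpM2l.
by rewrite mulrCA ler_wpM2l// QSn [leRHS]mulrC.
Qed.

(** Riemann sums of the nondecreasing [ln f]; the right-hand sum is the left-hand one shifted by one
    index, hence the two boundary terms. *)
Lemma F_sum_bounds l n : (0 < l)%N -> (2 * n <= l)%N ->
  \sum_(j < n) ln (f (j%:R / l%:R)) <= l%:R * F (n%:R / l%:R) <=
  \sum_(j < n) ln (f (j%:R / l%:R)) + ln (f (n%:R / l%:R)) - ln (f 0).
Proof.
move=> l0; elim: n => [|n IH] nl.
  by rewrite big_ord0 mul0r F0// mulr0 add0r subrr lexx.
have /andP[IH1 IH2] := IH ltac:(lia).
have r1 := @ratio_half l n ltac:(lia).
have r2 := @ratio_half l n.+1 ltac:(lia).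
have rle := @ratio_le l n n.+1 (leqnSn n).
have /andP[A1 A2] := F_increment beta_ge0 (u := n%:R / l%:R) (v := n.+1%:R / l%:R)
  ltac:(lra) rle ltac:(lra).
have dE : n.+1%:R / l%:R - n%:R / l%:R = l%:R^-1 :> R.
  by rewrite -mulrBl -natr1 addrAC subrr add0r mul1r.
have lR : 0 < l%:R :> R by rewrite ltr0n.
rewrite dE in A1 A2.
rewrite big_ord_recr/=.
set x := F _ in A1 A2 *; set y := F _ in A1 A2 IH1 IH2.
have {}A1 : ln (f (n%:R / l%:R)) <= l%:R * (x - y).
  by have := A1; rewrite -(ler_pM2l lR) mulrCA divff ?mulr1// gt_eqF.
have {}A2 : l%:R * (x - y) <= ln (f (n.+1%:R / l%:R)).
  by have := A2; rewrite -(ler_pM2l lR) mulrCA divff ?mulr1// gt_eqF.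
rewrite mulrBr in A1 A2.
by apply/andP; split; lra.
Qed.

(** The error 2 beta does not grow with a + b. In the lower bound it is the gap between the Riemann
    sums, at most - ln (f 0); in the upper bound it comes from the factor c in [pw_prod_bounds]. *)
Lemma pw_bounds a b : ~~ odd (a + b) -> (0 < a + b)%N ->
  expR ((a + b)%:R * F (a%:R / (a + b)%:R) - 2 * beta) <= pw c a b <=
  expR ((a + b)%:R * F (a%:R / (a + b)%:R) + 2 * beta).
Proof.
wlog ab : a b / (a <= b)%N.
  move=> wlg oab ab0; have [ab|ba] := leqP a b; first exact: wlg.
  have := wlg b a (ltnW ba); rewrite addnC => /(_ oab ab0).
  move=> /=; rewrite pwC; last by rewrite addnC.
  rewrite -(F_sym beta (b%:R / _)).
  have -> : 1 - b%:R / (a + b)%:R = a%:R / (a + b)%:R :> R.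
    by rewrite natrD; field; rewrite -natrD pnatr_eq0 -lt0n.
  by [].
move=> oab ab0; set l := (a + b)%N in oab ab0 *.
have nl : (2 * a <= l)%N by rewrite /l; lia.
have [H1 H2] := pw_prod_bounds oab ab0 nl.
have /andP[S1 S2] := F_sum_bounds ab0 nl.
have lb : (l - a = b)%N by rewrite /l addnC addnK.
rewrite lb in H1 H2.
have r12 := @ratio_half l a nl.
have QE : Q l a = expR (\sum_(j < a) ln (f (j%:R / l%:R))).
  rewrite expR_sum; apply: eq_bigr => j _; rewrite lnK// posrE (f_gt0 beta_ge0)//.
  by apply: ratio_half; have := ltn_ord j; lia.
have L0 : ln (f 0) = - 2 * beta by rewrite (f0 beta) expRK.
have La := ln_f_le0 beta_ge0 r12.
rewrite L0 in S1 S2; apply/andP; split.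
  by apply: le_trans H1; rewrite QE ler_expR; lra.
rewrite -(ler_pM2l (expR_gt0 (-2 * beta))); apply: (le_trans H2).
apply: (@le_trans _ _ (Q l a)).
  by rewrite ler_piMl ?(f_le1 beta_ge0)// ltW// ratio_prod_gt0.
by rewrite QE -expRD ler_expR; lra.
Qed.

(* The partial derivatives, at (x, 1 - x), of the homogeneous function
   (a, b) |-> (a + b) * (beta / 2 + F (a / (a + b))). *)
Definition lamp (x : R) : R := beta / 2 + F x + (1 - x) * dF x.
Definition lamm (x : R) : R := beta / 2 + F x - x * dF x.

Lemma lamm_lamp x : lamm x = lamp (1 - x).
Proof. by rewrite /lamm /lamp F_sym dF_sym//; ring. Qed.

Lemma lam_euler x : x * lamp x + (1 - x) * lamm x = beta / 2 + F x.
Proof. by rewrite /lamm /lamp; ring. Qed.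

Lemma lam_support x y : 0 <= x <= 1 -> 0 <= y <= 1 ->
  x * lamp y + (1 - x) * lamm y <= beta / 2 + F x.
Proof.
move=> x01 y01; have := F_support beta_ge0 y01 x01; rewrite /lamm /lamp; lra.
Qed.

(** [lamp x] is the tangent of beta / 2 + F at x, evaluated at 1, where F vanishes. This is where
    the exponent of the assumed moment comes from. *)
Lemma lamp_le x : 0 <= x <= 1 -> lamp x <= beta / 2.
Proof.
move=> x01; have := F_support beta_ge0 x01 (y := 1) ltac:(lra).
by rewrite -(F_sym beta 1) subrr F0 /lamp; lra.
Qed.

Lemma lamp_ge x : 0 <= x <= 1 -> - 4 * beta <= lamp x.
Proof.
move=> x01; have b0 := beta_ge0.
have := F_support beta_ge0 (x := 0) (y := x) ltac:(lra) x01.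
rewrite F0 add0r subr0 /lamp => H.
have := dF_bounds beta_ge0 x01.
have := dF_bounds beta_ge0 (x := 0) ltac:(lra).
nra.
Qed.

(** The tangent inequality at x bounds F x - F y and leaves (1 - y) * (dF x - dF y): closeness of
    slopes is enough, whether or not x and y are close. *)
Lemma lamp_lip x y : 0 <= x <= 1 -> 0 <= y <= 1 -> lamp x <= lamp y + `|dF x - dF y|.
Proof.
move=> x01 y01; have H := F_support beta_ge0 x01 y01.
have : (1 - y) * (dF x - dF y) <= `|dF x - dF y|.
  apply: le_trans (ler_norm _) _; rewrite normrM ler_piMl// ger0_norm; lra.
rewrite /lamp; lra.
Qed.

Lemma lamm_le x : 0 <= x <= 1 -> lamm x <= beta / 2.
Proof. by move=> x01; rewrite lamm_lamp lamp_le//; lra. Qed.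

Lemma lamm_ge x : 0 <= x <= 1 -> - 4 * beta <= lamm x.
Proof. by move=> x01; rewrite lamm_lamp lamp_ge//; lra. Qed.

Lemma lamm_lip x y : 0 <= x <= 1 -> 0 <= y <= 1 -> lamm x <= lamm y + `|dF x - dF y|.
Proof.
move=> x01 y01; rewrite !lamm_lamp.
have := @lamp_lip (1 - x) (1 - y) ltac:(lra) ltac:(lra).
by rewrite !dF_sym// -opprD normrN.
Qed.

Lemma pw_ge_expR a b N y : (a + b = 2 * N)%N -> 0 <= y <= 1 ->
  expR (lamp y * a%:R + lamm y * b%:R) <=
  expR (2 * beta) * (expR (beta * N%:R) * pw c a b).
Proof.
move=> abN y01; have b0 := beta_ge0.
have [ab0|ab0] := posnP (a + b).
  have [a0 bb0 N0] : [/\ a = 0, b = 0 & N = 0]%N by split; lia.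
  rewrite a0 bb0 N0 pw0 !mulr0 addr0 expR0 !mulr1 -[leLHS]expR0 ler_expR.
  by rewrite mulr_ge0.
have oab : ~~ odd (a + b) by rewrite abN mul2n odd_double.
have /andP[H _] := pw_bounds oab ab0.
rewrite -ler_pdivrMl ?expR_gt0// -expRN -ler_pdivrMl ?expR_gt0// -expRN -!expRD.
apply: le_trans H; rewrite ler_expR.
set l := (a + b)%:R.
have lE : l = 2 * N%:R by rewrite /l abN natrM.
have l0 : 0 < l by rewrite /l ltr0n.
have abE : l = a%:R + b%:R by rewrite /l natrD.
have x01 : 0 <= a%:R / l <= 1.
  by rewrite divr_ge0//= ler_pdivrMr// mul1r abE lerDl.
have lx : l * (a%:R / l) = a%:R by rewrite mulrCA divff ?mulr1// gt_eqF.
have lx' : l * (1 - a%:R / l) = b%:R by rewrite mulrBr lx mulr1 abE; ring.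
have := lam_support x01 y01.
rewrite -(ler_pM2l l0) mulrDr [l * (_ * lamp y)]mulrA [l * (_ * lamm y)]mulrA lx lx'.
move=> H.
have lb : l * (beta / 2) = beta * N%:R by rewrite lE; field.
lra.
Qed.

Lemma pw_le_expR a b N : (a + b = 2 * N)%N -> exists2 x, 0 <= x <= 1 &
  expR (beta * N%:R) * pw c a b <=
  expR (2 * beta) * expR (lamp x * a%:R + lamm x * b%:R).
Proof.
move=> abN; have b0 := beta_ge0.
have [ab0|ab0] := posnP (a + b).
  have [a0 bb0 N0] : [/\ a = 0, b = 0 & N = 0]%N by split; lia.
  exists 0; first by lra.
  rewrite a0 bb0 N0 pw0 !mulr0 addr0 expR0 !mulr1 -[leLHS]expR0 ler_expR.
  by rewrite mulr_ge0.
have oab : ~~ odd (a + b) by rewrite abN mul2n odd_double.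
have /andP[_ H] := pw_bounds oab ab0.
set l := (a + b)%:R in H.
have lE : l = 2 * N%:R by rewrite /l abN natrM.
have l0 : 0 < l by rewrite /l ltr0n.
have abE : l = a%:R + b%:R by rewrite /l natrD.
have x01 : 0 <= a%:R / l <= 1.
  by rewrite divr_ge0//= ler_pdivrMr// mul1r abE lerDl.
(* At the actual fraction of + half-edges Euler's identity makes the linear form equal to the
   exponent in [pw_bounds]. *)
exists (a%:R / l) => //.
apply: (le_trans (ler_wpM2l (expR_ge0 _) H)).
rewrite -!expRD ler_expR.
have lx : l * (a%:R / l) = a%:R by rewrite mulrCA divff ?mulr1// gt_eqF.
have lx' : l * (1 - a%:R / l) = b%:R by rewrite mulrBr lx mulr1 abE; ring.
have := congr1 (fun z => l * z) (lam_euler (a%:R / l)).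
rewrite /= mulrDr [l * (_ * lamp _)]mulrA [l * (_ * lamm _)]mulrA lx lx'.
move=> E.
have lb : l * (beta / 2) = beta * N%:R by rewrite lE; field.
lra.
Qed.

End pairing_asymptotics.

(** * Positivity of the rate at x = 1 / 2 *)

Lemma ler_of_natmul_bounded {R : realType} (x K : R) :
  (forall n : nat, n%:R * x <= K) -> x <= 0.
Proof.
move=> H; rewrite leNgt; apply/negP => x0.
have K0 : 0 <= K by have := H 0%N; rewrite mul0r.
have := archi_boundP (divr_ge0 K0 (ltW x0)); rewrite ltr_pdivrMr//.
by apply/negP; rewrite -leNgt.
Qed.

Section half.
Context {R : realType}.

Lemma pw_step (c m : R) a b N : 0 <= c -> 0 <= m -> (a.+1 + b = 2 * N.+1)%N ->
  (forall a' b', (a' + b' = 2 * N)%N -> m <= pw c a' b') ->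
  m * (a%:R + c * b%:R) <= (a + b)%:R * pw c a.+1 b.
Proof.
move=> c0 m0 abN H; rewrite pwS; last by lia.
rewrite mulrDr lerD//.
  case: a abN => [|a] abN; first by rewrite mulr0 mul0r.
  by rewrite mulrC ler_wpM2l// H//; lia.
case: b abN => [|b] abN; first by rewrite !mulr0 mul0r.
by rewrite mulrC ler_wpM2l ?mulr_ge0// H//; lia.
Qed.

Lemma pw_ge_pow (c : R) N a b : 0 < c <= 1 -> (a + b = 2 * N)%N -> c ^+ N <= pw c a b.
Proof.
move=> c01; have c0 : 0 <= c by lra.
elim: N a b => [|N IH] a b abN.
  by have [-> ->] : a = 0%N /\ b = 0%N by lia.
case: a abN => [|a] abN; first by rewrite pw0 exprn_ile1//; lra.
have ab0 : 0 < (a + b)%:R :> R by rewrite ltr0n; lia.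
rewrite -(ler_pM2l ab0); apply: le_trans (pw_step c0 (exprn_ge0 N c0) abN IH).
rewrite exprS natrD.
have : 0 <= c ^+ N * (1 - c) * a%:R by rewrite !mulr_ge0 ?exprn_ge0//; lra.
lra.
Qed.

(** By symmetry the revealed half-edge may be taken in the larger class; its partner is then alike
    with probability about 1 / 2 or more, so one edge contributes nearly (1 + c) / 2. The threshold
    n0 is where this contribution reaches t, and C = c ^ n0 absorbs the edges before it. *)
Lemma pw_ge_geometric (c t : R) : 0 < c -> c < t -> t < (1 + c) / 2 -> c <= 1 ->
  exists2 C, 0 < C & forall N a b, (a + b = 2 * N)%N -> C * t ^+ N <= pw c a b.
Proof.
move=> c0 ct tc c1.
have [n0 Hn0] : exists n0 : nat, (1 - t) / (1 + c - 2 * t) <= n0%:R.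
  exists (Num.bound ((1 - t) / (1 + c - 2 * t))); apply/ltW/archi_boundP.
  by rewrite divr_ge0//; lra.
rewrite ler_pdivrMr in Hn0; last by lra.
exists (c ^+ n0); first by rewrite exprn_gt0.
elim=> [|N IH] a b abN.
  have [-> ->] : a = 0%N /\ b = 0%N by lia.
  by rewrite pw0 mulr1 exprn_ile1//; lra.
have [Nn|Nn] := leqP N.+1 n0.
  apply: le_trans (pw_ge_pow _ abN); last by lra.
  rewrite -[leRHS]mulr1 ler_pM ?exprn_ge0//; [by lra|by lra| |by rewrite exprn_ile1//; lra].
  by rewrite ler_wiXn2l//; lra.
wlog ba : a b abN / (b <= a)%N.
  move=> wlg; have [ba|ab] := leqP b a; first exact: wlg.
  rewrite pwC; last by rewrite abN mul2n odd_double.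
  by apply: wlg; [rewrite addnC|exact: ltnW].
case: a abN ba => [|a] abN ba; first by lia.
have ab0 : 0 < (a + b)%:R :> R by rewrite ltr0n; lia.
rewrite -(ler_pM2l ab0).
have m0 : 0 <= c ^+ n0 * t ^+ N by rewrite mulr_ge0 ?exprn_ge0//; lra.
apply: le_trans (pw_step (ltW c0) m0 abN IH).
rewrite exprS.
have -> : (a + b)%:R * (c ^+ n0 * (t * t ^+ N)) = c ^+ n0 * t ^+ N * (t * (a + b)%:R) by ring.
rewrite ler_wpM2l// natrD.
have b_le : b%:R <= a%:R + 1 :> R by rewrite natr1 ler_nat.
have aN : n0%:R <= a%:R + 1 :> R by rewrite natr1 ler_nat; lia.
have H1 : n0%:R * (1 + c - 2 * t) <= (a%:R + 1) * (1 + c - 2 * t).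
  by rewrite ler_wpM2r//; lra.
have H2 : (t - c) * b%:R <= (t - c) * (a%:R + 1) by rewrite ler_wpM2l//; lra.
lra.
Qed.

Variable beta : R.
Hypothesis beta_gt0 : 0 < beta.

(** The slope of F vanishes at 1 / 2, which leaves beta / 2 + F (1 / 2). With n half-edges of each
    kind the weight is at least C * t ^ n for some t > exp (- beta), and at most exp (2 n F (1 / 2)
    + 2 beta) by [pw_bounds]; comparing rates gives F (1 / 2) > - beta / 2. *)
Lemma lamp_half_gt0 : 0 < lamp beta (1 / 2).
Proof.
have b0 := beta_gt0; have b0' := ltW beta_gt0.
rewrite /lamp /dF lexx ln_f_half mulr0 addr0.
set e := expR (- beta).
have e0 : 0 < e by exact: expR_gt0.
have e1 : e < 1 by rewrite -[ltRHS]expR0 ltr_expR oppr_lt0.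
have ce : expR (- 2 * beta) = e ^+ 2 by rewrite -expRM_natr; congr expR; ring.
(* The midpoint between exp (- beta) and (1 + c) / 2, which differ by (1 - e) ^ 2 / 2. *)
pose t := (e + (1 + e ^+ 2) / 2) / 2.
have sq : 0 < (1 - e) ^+ 2 by rewrite exprn_gt0//; lra.
have e2 : e ^+ 2 < e by rewrite expr2 gtr_pMr.
have e20 : 0 < e ^+ 2 by rewrite exprn_gt0.
have [C C0 HC] := @pw_ge_geometric (e ^+ 2) t ltac:(lra) ltac:(rewrite /t; lra)
  ltac:(rewrite /t; lra) ltac:(lra).
have et : e < t by rewrite /t; lra.
have t0 : 0 < t by lra.
suff : ln t - 2 * F_ beta (1 / 2) <= 0.
  have : - beta < ln t by rewrite -[ltLHS]expRK -/e ltr_ln ?posrE.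
  lra.
apply: (@ler_of_natmul_bounded _ _ (`|2 * beta - ln C|)) => -[|N].
  by rewrite mul0r.
set n := N.+1.
have nn : (n + n = 2 * n)%N by rewrite mul2n addnn.
have onn : ~~ odd (n + n) by rewrite addnn odd_double.
have H := HC n n n nn.
have /andP[_] := pw_bounds b0' onn (ltn_addr _ (ltn0Sn N)).
rewrite ce => /(le_trans H).
have -> : n%:R / (n + n)%:R = 1 / 2 :> R.
  have n0 : n%:R != 0 :> R by rewrite pnatr_eq0.
  by rewrite natrD -mulr2n -mulr_natr; field.
rewrite -[X in X <= _ -> _]lnK ?posrE ?mulr_gt0 ?exprn_gt0// ler_expR.
rewrite lnM ?posrE ?exprn_gt0// lnXn// natrD -[ln t *+ n]mulr_natr => H2.
apply: le_trans (ler_norm _); lra.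
Qed.

End half.

(** * Expectations of products of independent degrees *)

Section discrete_expectation.
Context {R : realType} {d : measure_display} {T : measurableType d}
  (P : probability T R).

Lemma measurable_preimage_RV (Y : {RV P >-> nat}) (A : set nat) :
  measurable (Y @^-1` A).
Proof. by rewrite -[X in measurable X]setTI; exact: measurable_funPT. Qed.

(** Finitely many degrees take countably many joint values, so every preimage is a countable union
    of measurable sets. *)
Lemma measurable_comp_RVs (X : nat -> {RV P >-> nat}) n
    (G : ('I_n -> nat) -> R) :
  measurable_fun setT (fun w => G (fun i => X i w)).
Proof.
move=> _ A mA; rewrite setTI.
have -> : (fun w => G (fun i => X i w)) @^-1` A =
  \bigcup_(t : n.-tuple nat)
    ([set w | A (G (tnth t))] `&` \bigcap_(i in [set: 'I_n]) (X i @^-1` [set tnth t i])).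
  apply/seteqP; split=> w /=.
    move=> Aw; exists [tuple X i w | i < n] => //; split=> /=.
      by have -> : tnth [tuple X i w | i < n] = (fun i : 'I_n => X i w)
        by apply/funext => i; rewrite tnth_mktuple.
    by move=> i _ /=; rewrite tnth_mktuple.
  move=> [t _ [At Xt]]; have -> // : (fun i : 'I_n => X i w) = tnth t.
  by apply/funext => i; exact: Xt.
apply: countable_bigcupT_measurable; first exact: countableP.
move=> t; apply: measurableI; last first.
  apply: fin_bigcap_measurable; first exact: finite_finset.
  by move=> i _; exact: measurable_preimage_RV.
have [At|nAt] := pselect (A (G (tnth t))).
  by have -> : [set _ : T | A (G (tnth t))] = setT by apply/seteqP; split.
by have -> : [set _ : T | A (G (tnth t))] = set0 by apply/seteqP; split.
Qed.

Lemma expectation_nat (Y : {RV P >-> nat}) (phi : nat -> R) :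
  (forall k, 0 <= phi k) ->
  ('E_P[fun w => phi (Y w)] = \sum_(k <oo) (degree_law Y k * phi k)%:E)%E.
Proof.
move=> phi0; rewrite unlock.
have -> : setT = \bigcup_k (Y @^-1` [set k]).
  by apply/seteqP; split=> w // _; exists (Y w).
rewrite ge0_integral_bigcup; last 4 first.
- by move=> k; exact: measurable_preimage_RV.
- apply/measurable_EFinP; rewrite (_ : \bigcup_k _ = setT); last first.
    by apply/seteqP; split=> w // _; exists (Y w).
  exact: (@measurable_comp_RVs (fun=> Y) 1 (fun k => phi (k ord0))).
- by move=> x _; rewrite lee_fin.
- apply/trivIsetP => i j _ _ ij; rewrite -preimage_setI; apply/seteqP.
  by split=> w //= -[-> /eqP]; rewrite (negbTE ij).
apply: eq_eseriesr => k _.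
rewrite (eq_integral (fun=> (phi k)%:E)); last by move=> w; rewrite inE => /= ->.
rewrite integral_cst; last exact: measurable_preimage_RV.
rewrite mulrC EFinM /degree_law fineK//.
exact: (fin_num_measure P _ (measurable_preimage_RV Y [set k])).
Qed.

End discrete_expectation.

Section iid_products.
Context {R : realType} {d0 : measure_display} {T : measurableType d0}
  (P0 : probability T R) (D : {RV P0 >-> nat})
  {d : measure_display} {Omega : measurableType d} (P : probability Omega R)
  (X : nat -> {RV P >-> nat}).
Hypothesis X_iid : iid_copies D X.

Let p := degree_law D.

Lemma iid_law i k : P (X i @^-1` [set k]) = (p k)%:E.
Proof.
have [_ ->] := X_iid; rewrite /p /degree_law fineK//.
exact: (fin_num_measure P0 _ (measurable_preimage_RV D [set k])).
Qed.

Variable (phi : nat -> R) (s : R).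
Hypothesis phi0 : forall k, 0 <= phi k.
Hypothesis Es : (\sum_(k <oo) (p k * phi k)%:E = s%:E)%E.

Let cyl m n (k : nat -> nat) : set Omega :=
  [set w | forall i, (m <= i < n)%N -> X i w = k i].

Let cylE m n k : cyl m n k =
  \bigcap_(i in [set` [fset i in iota m (n - m)]%fset]) (X i @^-1` [set k i]).
Proof.
apply/seteqP; split=> w /= H i.
  by rewrite /= in_fset/= mem_iota => /andP[mi ii]; apply: H; rewrite mi; lia.
by move=> /andP[mi ii]; apply: H; rewrite /= in_fset/= mem_iota mi; lia.
Qed.

Let measurable_cyl m n k : measurable (cyl m n k).
Proof.
rewrite cylE; apply: fin_bigcap_measurable; first exact: finite_fset.
by move=> i _; exact: measurable_preimage_RV.
Qed.

Let prob_cyl n k : P (cyl 0 n k) = (\prod_(0 <= i < n) p (k i))%:E.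
Proof.
rewrite cylE subn0; have [-> _] := X_iid.
rewrite (eq_bigr (fun i => (p (k i))%:E)); last by move=> i _; exact: iid_law.
rewrite prodEFin; congr _%:E.
apply: perm_big; apply: uniq_perm; rewrite ?fset_uniq ?iota_uniq// => i.
by rewrite in_fset /index_iota subn0.
Qed.

Let cylS m n k : (m < n)%N ->
  cyl m.+1 n k = \bigcup_j cyl m n (fun i => if i == m then j else k i).
Proof.
move=> mn; apply/seteqP; split=> w.
  move=> H; exists (X m w) => // i /andP[mi ii]; case: eqP => [->//|/eqP im].
  by apply: H; rewrite ii andbT ltn_neqAle eq_sym im.
move=> [j _ H] i /andP[mi ii]; rewrite H ?(ltnW mi)// ?ii//.
by rewrite gtn_eqF.
Qed.

Let measurable_prod_X m :
  measurable_fun setT (EFin \o (fun w => \prod_(i < m) phi (X i w) : R)).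
Proof.
apply/measurable_EFinP.
exact: (measurable_comp_RVs X (fun k : 'I_m -> nat => \prod_(i < m) phi (k i))).
Qed.

(** The product formula is drawn from cylinder probabilities alone: coordinates m, ..., n - 1 are
    prescribed, and each induction step frees one more by summing over its value. *)
Let integral_cyl m n k : (m <= n)%N ->
  (\int[P]_(w in cyl m n k) (\prod_(i < m) phi (X i w))%:E =
   (s ^+ m * \prod_(m <= i < n) p (k i))%:E)%E.
Proof.
elim: m k => [|m IH] k mn.
  rewrite (eq_integral (fun=> 1%E)); last by move=> w _; rewrite big_ord0.
  rewrite integral_cst// mul1e expr0 mul1r; exact: prob_cyl.
rewrite cylS// ge0_integral_bigcup; last 4 first.
- by move=> j; exact: measurable_cyl.
- exact: measurable_funS (measurable_prod_X m.+1).
- by move=> w _; rewrite lee_fin prodr_ge0.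
- apply/trivIsetP => i j _ _ ij; apply/seteqP; split=> w //= -[Hi Hj].
  have := Hi m; rewrite leqnn mn eqxx => /(_ isT) Xi.
  have := Hj m; rewrite leqnn mn eqxx => /(_ isT) Xj.
  by rewrite -Xi -Xj eqxx in ij.
have E j : (\int[P]_(w in cyl m n (fun i => if i == m then j else k i))
    (\prod_(i < m.+1) phi (X i w))%:E =
  (s ^+ m * \prod_(m.+1 <= i < n) p (k i))%:E * (p j * phi j)%:E)%E.
  rewrite (eq_integral (fun w => (phi j)%:E * (\prod_(i < m) phi (X i w))%:E)%E); last first.
    move=> w; rewrite inE => /(_ m); rewrite leqnn mn eqxx => /(_ isT) Xj.
    by rewrite big_ord_recr/= Xj mulrC EFinM.
  rewrite ge0_integralZl//; last 3 first.
  - exact: measurable_funS (measurable_prod_X m).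
  - by move=> w _; rewrite lee_fin prodr_ge0.
  - by rewrite lee_fin.
  rewrite IH 1?ltnW// -!EFinM big_ltn// eqxx; congr _%:E.
  rewrite (eq_big_nat _ _ (F2 := fun i => p (k i))); last first.
    by move=> i /andP[mi _]; rewrite gtn_eqF.
  by ring.
rewrite (eq_eseriesr (fun j _ => E j)) nneseriesZl; last first.
  by move=> j _; rewrite lee_fin mulr_ge0// fine_ge0.
by rewrite Es -EFinM exprSr; congr _%:E; ring.
Qed.

Lemma integral_prod_iid n : (\int[P]_w (\prod_(i < n) phi (X i w))%:E = (s ^+ n)%:E)%E.
Proof.
have := @integral_cyl n n (fun=> 0%N) (leqnn n).
rewrite big_geq// mulr1 => <-; congr (integral _ _ _).
by apply/esym/seteqP; split=> // w _ i; rewrite leqNgt => /andP[/negP].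
Qed.

End iid_products.

Section dominated_means.
Context {R : realType}.
Variables (p h : nat -> R) (m : R).
Hypothesis p_ge0 : forall k, 0 <= p k.
Hypothesis h_ge0 : forall k, 0 <= h k.
Hypothesis hm : (\sum_(k <oo) (p k * h k)%:E = m%:E)%E.

Definition dmean (phi : nat -> R) : R := fine (\sum_(k <oo) (p k * phi k)%:E)%E.

(** The class on which means are finite and additive; [h] will be exp (beta k / 2), the function
    whose mean is assumed finite. *)
Definition dominated (phi : nat -> R) : Prop :=
  (forall k, 0 <= phi k) /\ exists K, forall k, phi k <= K * h k.

Lemma dmeanE phi : dominated phi -> (\sum_(k <oo) (p k * phi k)%:E = (dmean phi)%:E)%E.
Proof.
move=> [phi0 [K phiK]]; rewrite /dmean fineK// ge0_fin_numE; last first.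
  by apply: nneseries_ge0 => k _ _; rewrite lee_fin mulr_ge0.
apply: (@le_lt_trans _ _ (\sum_(k <oo) (`|K| * (p k * h k))%:E)%E).
  apply: lee_nneseries => k _; first by rewrite lee_fin mulr_ge0.
  rewrite lee_fin mulrCA ler_wpM2l//; apply: (le_trans (phiK k)).
  by rewrite ler_wpM2r// ler_norm.
under eq_eseriesr do rewrite EFinM.
rewrite nneseriesZl ?hm ?ltry//.
by move=> k _; rewrite lee_fin mulr_ge0.
Qed.

Lemma dominatedD phi psi : dominated phi -> dominated psi ->
  dominated (fun k => phi k + psi k).
Proof.
move=> [f0 [K fK]] [g0 [L gL]]; split; first by move=> k; rewrite addr_ge0.
by exists (K + L) => k; rewrite mulrDl lerD.
Qed.

Lemma dominatedZ (c : R) phi : 0 <= c -> dominated phi -> dominated (fun k => c * phi k).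
Proof.
move=> c0 [f0 [K fK]]; split; first by move=> k; rewrite mulr_ge0.
by exists (c * K) => k; rewrite -mulrA ler_wpM2l.
Qed.

Lemma dominated_le phi psi : (forall k, 0 <= phi k) -> (forall k, phi k <= psi k) ->
  dominated psi -> dominated phi.
Proof.
move=> f0 fg [_ [K gK]]; split=> //; exists K => k; exact: le_trans (fg k) (gK k).
Qed.

Lemma le_dmean phi psi : (forall k, 0 <= phi k) -> (forall k, phi k <= psi k) ->
  dominated psi -> dmean phi <= dmean psi.
Proof.
move=> f0 fg dg; rewrite -lee_fin -!dmeanE//; last exact: dominated_le dg.
apply: lee_nneseries => k _; first by rewrite lee_fin mulr_ge0.
by rewrite lee_fin ler_wpM2l.
Qed.

Lemma dmeanD phi psi : dominated phi -> dominated psi ->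
  dmean (fun k => phi k + psi k) = dmean phi + dmean psi.
Proof.
move=> df dg; apply: EFin_inj; rewrite EFinD -!dmeanE//; last exact: dominatedD.
rewrite -nneseriesD.
- by apply: eq_eseriesr => k _; rewrite mulrDr EFinD.
- by move=> k _ _; rewrite lee_fin mulr_ge0//; case: df.
- by move=> k _ _; rewrite lee_fin mulr_ge0//; case: dg.
Qed.

Lemma dmeanZ (c : R) phi : 0 <= c -> dominated phi ->
  dmean (fun k => c * phi k) = c * dmean phi.
Proof.
move=> c0 df; apply: EFin_inj; rewrite EFinM -!dmeanE//; last exact: dominatedZ.
rewrite -nneseriesZl; last by move=> k _; rewrite lee_fin mulr_ge0//; case: df.
by apply: eq_eseriesr => k _; rewrite mulrCA EFinM.
Qed.

Lemma dominated_h : dominated h.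
Proof. by split=> //; exists 1 => k; rewrite mul1r. Qed.

Lemma dmean_ge_sum phi n : dominated phi -> \sum_(k < n) p k * phi k <= dmean phi.
Proof.
move=> df; rewrite -lee_fin -dmeanE// -sumEFin -(big_mkord xpredT (fun k => (p k * phi k)%:E)).
by apply: nneseries_lim_ge => k _ _; rewrite lee_fin mulr_ge0//; case: df.
Qed.

Lemma dmean_sum_cvg phi : dominated phi ->
  \sum_(k < n) p k * phi k @[n --> \oo] --> dmean phi.
Proof.
move=> df; have f0 k : 0 <= phi k by case: df.
have : (\sum_(0 <= k < n) (p k * phi k)%:E)%E @[n --> \oo] --> (dmean phi)%:E.
  rewrite -dmeanE//; apply: is_cvg_nneseries => k _ _.
  by rewrite lee_fin mulr_ge0.
move/fine_cvgP => [_]; apply: cvg_trans; apply: near_eq_cvg; near=> n.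
by rewrite /= sumEFin big_mkord.
Unshelve. all: by end_near. Qed.

Lemma dmean_tail (e : R) : 0 < e ->
  exists K, dmean (fun k => if (K <= k)%N then h k else 0) <= e.
Proof.
move=> e0.
have H : \sum_(k < n) p k * h k @[n --> \oo] --> m.
  have -> : m = dmean h by rewrite /dmean hm.
  exact: dmean_sum_cvg dominated_h.
have /cvgrPdist_le/(_ e e0) [K _ HK] := H.
exists K; set t := fun k => _.
have dt : dominated t.
  apply: (@dominated_le _ h) dominated_h => k; rewrite /t; by case: ifP.
pose b := fun k => if (K <= k)%N then 0 else h k.
have db : dominated b.
  apply: (@dominated_le _ h) dominated_h => k; rewrite /b; by case: ifP.
have hE : dmean h = dmean b + dmean t.
  rewrite -dmeanD//; congr dmean; apply/funext => k; rewrite /b /t.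
  by case: ifP; rewrite ?addr0 ?add0r.
have bE : \sum_(k < K) p k * h k <= dmean b.
  apply: le_trans (dmean_ge_sum K db); apply: ler_sum => k _.
  by rewrite /b leqNgt ltn_ord.
have := HK K (leqnn K); have -> : m = dmean h by rewrite /dmean hm.
move=> /(le_trans (ler_norm _)); rewrite hE; lra.
Qed.

(** For h k = exp (beta k / 2) this is left continuity of the exponential moment at beta / 2. The
    tail k >= K is small by summability, and below K one has 1 - exp (- d k) <= d K. *)
Lemma dmean_left_cont (e : R) : 0 < e -> exists2 d, 0 < d &
  dmean (fun k => h k * (1 - expR (- d * k%:R))) <= e.
Proof.
move=> e0; have [K HK] := @dmean_tail (e / 2) ltac:(lra).
have m0 : 0 <= m by rewrite -lee_fin -hm nneseries_ge0// => k _ _; rewrite lee_fin mulr_ge0.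
(* Chosen to make the head d * K * m at most e / 2; the added ones keep the denominator positive. *)
pose d := e / 2 / ((m + 1) * (K%:R + 1)).
have K0 : 0 < K%:R + 1 :> R by rewrite ltr_wpDl.
have mK : 0 < (m + 1) * (K%:R + 1) by rewrite mulr_gt0// ltr_wpDl.
have d0 : 0 < d by rewrite /d divr_gt0//; lra.
exists d => //.
set t := fun k => if (K <= k)%N then h k else 0 in HK.
have dt : dominated t.
  apply: (@dominated_le _ h) dominated_h => k; rewrite /t; by case: ifP.
have dz : dominated (fun k => d * K%:R * h k).
  by apply: dominatedZ dominated_h; rewrite mulr_ge0 ?(ltW d0).
have expk k : 0 <= expR (- d * k%:R) <= 1.
  by rewrite expR_ge0 /= -[leRHS]expR0 ler_expR mulNr oppr_le0 mulr_ge0// ltW.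
apply: (@le_trans _ _ (dmean (fun k => d * K%:R * h k + t k))).
  apply: le_dmean; last exact: dominatedD.
    by move=> k; rewrite mulr_ge0// subr_ge0; case/andP: (expk k).
  move=> k; rewrite /t; case: leqP => Kk.
    have H1 : 0 <= d * K%:R * h k by rewrite mulr_ge0// mulr_ge0// ltW.
    have : h k * (1 - expR (- d * k%:R)) <= h k * 1.
      by rewrite ler_wpM2l// lerBlDr lerDl expR_ge0.
    lra.
  rewrite addr0 mulrC ler_wpM2r//.
  have := expR_ge1Dx (- d * k%:R).
  have : d * k%:R <= d * K%:R by rewrite ler_wpM2l ?(ltW d0)// ler_nat ltnW.
  lra.
rewrite dmeanD// dmeanZ//; last 2 first.
- by rewrite mulr_ge0 ?(ltW d0).
- exact: dominated_h.
have -> : dmean h = m by rewrite /dmean hm.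
have : d * K%:R * m <= e / 2.
  have -> : e / 2 = d * ((m + 1) * (K%:R + 1)) by rewrite /d divfK// gt_eqF.
  rewrite -mulrA ler_wpM2l ?(ltW d0)//.
  have : 0 <= K%:R :> R by [].
  nra.
lra.
Qed.

End dominated_means.

(** * Mean-field bounds on the partition function *)

Section mean_field_weights.
Context {R : realType}.
Implicit Types (beta B u v x : R).

(** The factor of a vertex of degree k, summed over its spin; u and v are the rates per half-edge at
    a + and at a - vertex. *)
Definition wt B u v (k : nat) : R := expR (B + u * k%:R) + expR (- B + v * k%:R).

Lemma wt_gt0 B u v k : 0 < wt B u v k.
Proof. by rewrite addr_gt0 ?expR_gt0. Qed.

Lemma sum_spin_prod n (d : 'I_n -> nat) B u v :
  \sum_(sigma : {ffun 'I_n -> bool}) expR (B * \sum_i spin sigma i) *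
    expR (u * (\sum_(i | sigma i) d i)%:R + v * (\sum_(i | ~~ sigma i) d i)%:R) =
  \prod_i wt B u v (d i).
Proof.
rewrite (eq_bigr (fun i => \sum_(b : bool)
    expR (if b then B + u * (d i)%:R else - B + v * (d i)%:R))); last first.
  by move=> i _; rewrite big_bool.
rewrite bigA_distr_bigA; apply: eq_bigr => sigma _.
rewrite -expRD -expR_sum; congr expR.
rewrite !natr_sum !mulr_sumr [X in _ + (X + _)]big_mkcond [X in _ + (_ + X)]big_mkcond/=.
rewrite -!big_split/=; apply: eq_bigr => i _; rewrite /spin.
by case: (sigma i) => /=; ring.
Qed.

Lemma sum_fix_parity n (d : 'I_n -> nat) : (0 < n)%N ->
  (\sum_i fix_parity d i = \sum_i d i + odd (\sum_i d i))%N.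
Proof.
case: n d => // n d _; rewrite /fix_parity big_split/=; congr addn.
set o := odd _; rewrite (bigD1 ord_max)//= eqxx andTb big1 ?addn0// => i im.
by rewrite -[_ == _]/(i.+1 == n.+1) eqSS -[n]/(val (@ord_max n)) (inj_eq val_inj) (negbTE im).
Qed.

Lemma fix_parity_even n (d : 'I_n -> nat) : (0 < n)%N ->
  (\sum_i fix_parity d i = 2 * (\sum_i fix_parity d i)./2)%N.
Proof.
move=> n0; rewrite mul2n -[LHS]odd_double_half sum_fix_parity// oddD.
by case: (odd _).
Qed.

Lemma wtSE B u v k :
  wt B u v k.+1 = expR u * expR (B + u * k%:R) + expR v * expR (- B + v * k%:R).
Proof. by rewrite /wt -!expRD -natr1; congr (expR _ + expR _); ring. Qed.

Lemma wtS_le B u v k K : expR u <= K -> expR v <= K ->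
  wt B u v k.+1 <= K * wt B u v k.
Proof. by move=> uK vK; rewrite wtSE mulrDr lerD// ler_wpM2r ?expR_ge0. Qed.

Lemma wtS_ge B u v k K : K <= expR u -> K <= expR v ->
  K * wt B u v k <= wt B u v k.+1.
Proof. by move=> uK vK; rewrite wtSE mulrDr lerD// ler_wpM2r ?expR_ge0. Qed.

Let parity_defect n (d : 'I_n -> nat) (i : 'I_n) : bool :=
  (i.+1 == n) && odd (\sum_j d j).

Let sum_parity_defect n (d : 'I_n -> nat) : (0 < n)%N ->
  (\sum_i parity_defect d i <= 1)%N.
Proof.
move=> n0; have := sum_fix_parity d n0.
by rewrite /fix_parity big_split/= => /addnI; rewrite /parity_defect => ->; case: odd.
Qed.

(** At most one vertex receives an extra half-edge, and this multiplies its factor by at most K. *)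
Lemma prod_wt_parity_le n (d : 'I_n -> nat) B u v K : (0 < n)%N ->
  1 <= K -> expR u <= K -> expR v <= K ->
  \prod_i wt B u v (fix_parity d i) <= K * \prod_i wt B u v (d i).
Proof.
move=> n0 K1 uK vK.
apply: (@le_trans _ _ (\prod_i (K ^+ parity_defect d i * wt B u v (d i)))).
  apply: ler_prod => i _; rewrite ltW ?wt_gt0//= /fix_parity -/(parity_defect d i).
  by case: parity_defect; rewrite ?addn1 ?addn0 ?mul1r// expr1 wtS_le.
rewrite big_split/= ler_wpM2r ?prodr_ge0//; first by move=> i _; rewrite ltW ?wt_gt0.
rewrite prodrXr -[leRHS]expr1 ler_weXn2l//.
exact: sum_parity_defect.
Qed.

Lemma prod_wt_parity_ge n (d : 'I_n -> nat) B u v K : (0 < n)%N ->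
  0 <= K <= 1 -> K <= expR u -> K <= expR v ->
  K * \prod_i wt B u v (d i) <= \prod_i wt B u v (fix_parity d i).
Proof.
move=> n0 /andP[K0 K1] uK vK.
apply: (@le_trans _ _ (\prod_i (K ^+ parity_defect d i * wt B u v (d i)))).
  rewrite big_split/= ler_wpM2r ?prodr_ge0//; first by move=> i _; rewrite ltW ?wt_gt0.
  rewrite prodrXr -[leLHS]expr1 ler_wiXn2l//.
  exact: sum_parity_defect.
apply: ler_prod => i _.
rewrite mulr_ge0 ?exprn_ge0 ?(ltW (wt_gt0 _ _ _ _))//= /fix_parity -/(parity_defect d i).
by case: parity_defect; rewrite ?addn1 ?addn0 ?mul1r// expr1 wtS_ge.
Qed.

End mean_field_weights.

Section pointwise_bounds.
Context {R : realType}.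
Variables beta B : R.
Hypothesis beta_ge0 : 0 <= beta.

Lemma pairing_mean_Z_ge n (d : 'I_n -> nat) x : (0 < n)%N -> 0 <= x <= 1 ->
  expR (- 6 * beta) * \prod_i wt B (lamp beta x) (lamm beta x) (d i) <=
  pairing_mean_Z (fix_parity d) beta B.
Proof.
move=> n0 x01; have b0 := beta_ge0.
rewrite (pairing_mean_ZE beta B (fix_parity_even d n0)).
set N := (_./2).
(* The error of [pw_ge_expR] is 2 beta; by [lamp_ge] and [lamm_ge] the parity half-edge costs at
   most 4 beta. *)
have -> : expR (- 6 * beta) = expR (- (2 * beta)) * expR (- 4 * beta).
  by rewrite -expRD; congr expR; ring.
have K01 : 0 <= expR (- 4 * beta) <= 1.
  by rewrite expR_ge0 -[leRHS]expR0 ler_expR mulNr oppr_le0 mulr_ge0.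
rewrite -mulrA.
apply: (@le_trans _ _ (expR (- (2 * beta)) *
    \prod_i wt B (lamp beta x) (lamm beta x) (fix_parity d i))).
  rewrite ler_wpM2l ?expR_ge0// prod_wt_parity_ge// ler_expR.
    exact: lamp_ge.
  exact: lamm_ge.
rewrite -sum_spin_prod mulr_sumr; apply: ler_sum => sigma _.
rewrite mulrCA ler_wpM2l ?expR_ge0// expRN ler_pdivrMl ?expR_gt0//.
apply: pw_ge_expR => //.
rewrite -(fix_parity_even d n0).
by rewrite [RHS](bigID (fun i => sigma i)).
Qed.

(** The pairs in s need only dominate the rates, which leaves room for rounding up. The constant is
    2 beta from [pw_le_expR] plus beta for the parity half-edge. *)
Lemma pairing_mean_Z_le n (d : 'I_n -> nat) (s : seq (R * R)) : (0 < n)%N ->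
  {in s, forall y, y.1 <= beta / 2 /\ y.2 <= beta / 2} ->
  (forall x, 0 <= x <= 1 ->
     exists2 y, y \in s & lamp beta x <= y.1 /\ lamm beta x <= y.2) ->
  pairing_mean_Z (fix_parity d) beta B <=
  expR (3 * beta) * \sum_(y <- s) \prod_i wt B y.1 y.2 (d i).
Proof.
move=> n0 s_le s_cover; have b0 := beta_ge0.
rewrite (pairing_mean_ZE beta B (fix_parity_even d n0)).
set N := (_./2).
have -> : expR (3 * beta) = expR (2 * beta) * expR beta.
  by rewrite -expRD; congr expR; ring.
apply: (@le_trans _ _ (expR (2 * beta) *
    \sum_(y <- s) \prod_i wt B y.1 y.2 (fix_parity d i))); last first.
  rewrite -mulrA ler_wpM2l ?expR_ge0// mulr_sumr big_seq [leRHS]big_seq ler_sum// => y ys.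
  have [y1 y2] := s_le _ ys.
  apply: prod_wt_parity_le => //.
  - by rewrite -[leLHS]expR0 ler_expR.
  - by rewrite ler_expR; apply: (le_trans y1); lra.
  - by rewrite ler_expR; apply: (le_trans y2); lra.
rewrite (eq_bigr _ (fun y _ => esym (sum_spin_prod _ B y.1 y.2))) exchange_big/= mulr_sumr.
apply: ler_sum => sigma _.
rewrite -mulr_sumr [leRHS]mulrCA ler_wpM2l ?expR_ge0//.
have abN : (\sum_(i | sigma i) fix_parity d i +
    \sum_(i | ~~ sigma i) fix_parity d i = 2 * N)%N.
  by rewrite -(fix_parity_even d n0) [RHS](bigID (fun i => sigma i)).
have [x x01] := pw_le_expR b0 abN.
move=> /le_trans; apply; rewrite ler_wpM2l ?expR_ge0//.
have [y ys [y1 y2]] := s_cover x x01.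
rewrite (big_rem _ ys)/= ler_wpDr//.
  by rewrite sumr_ge0// => z _; rewrite expR_ge0.
by rewrite ler_expR lerD// ler_wpM2r.
Qed.

End pointwise_bounds.

(** * The limit of the annealed pressure *)

(** The range, not the domain, is cut into J strips of height e, and a point of A is chosen in every
    strip that h visits. *)
Lemma finite_value_net {R : realType} (A : set R) (h : R -> R) (a b e : R) : 0 < e ->
  (forall x, A x -> a <= h x <= b) ->
  exists s : seq R, {in s, forall y, A y} /\
    forall x, A x -> exists2 y, y \in s & `|h x - h y| <= e.
Proof.
move=> e0 hab.
have [J HJ] : exists J : nat, b - a <= J%:R * e.
  exists (Num.bound (`|b - a| / e)).
  have := archi_boundP (divr_ge0 (normr_ge0 (b - a)) (ltW e0)).
  by rewrite ltr_pdivrMr// => /ltW; apply: le_trans (ler_norm _).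
have {HJ}hab' : forall x, A x -> a <= h x <= a + J%:R * e.
  by move=> x /hab; lra.
elim: J A {hab} hab' => [|J IH] A hab.
  have [[x0 Ax0]|nA] := pselect (exists x, A x).
    exists [:: x0]; split; first by move=> y; rewrite inE => /eqP->.
    move=> x Ax; exists x0; first by rewrite inE.
    have := hab _ Ax; have := hab _ Ax0; rewrite mul0r addr0 => h1 h2.
    have -> : h x = h x0 by lra.
    by rewrite subrr normr0 ltW.
  by exists [::]; split=> // x Ax; exfalso; apply: nA; exists x.
have [s [sA sc]] := IH (fun x => A x /\ h x <= a + J%:R * e) ltac:(
  move=> x [/hab/andP[-> _] ->] //).
have [[x0 [Ax0 hx0]]|nA] := pselect (exists x, A x /\ a + J%:R * e < h x).
  exists (x0 :: s); split.
    by move=> y; rewrite inE => /orP[/eqP->//|/sA[]].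
  move=> x Ax; have [hx|hx] := leP (h x) (a + J%:R * e).
    by have [y ys hy] := sc x (conj Ax hx); exists y => //; rewrite inE ys orbT.
  exists x0; first by rewrite inE eqxx.
  have := hab _ Ax; have := hab _ Ax0; rewrite -natr1 => h1 h2.
  by rewrite ler_norml; lra.
exists s; split; first by move=> y /sA[].
move=> x Ax; apply: sc; split=> //; rewrite leNgt; apply/negP => hx.
by apply: nA; exists x.
Qed.

Lemma growth_rate_cvg {R : realType} (A : nat -> R) (E0 : R) : 0 < E0 ->
  (forall r, E0 < r -> exists2 C, 0 < C & forall n, (0 < n)%N -> A n <= C * r ^+ n) ->
  (forall r, 0 < r < E0 -> exists2 C, 0 < C & forall n, (0 < n)%N -> C * r ^+ n <= A n) ->
  n%:R^-1 * ln (A n) @[n --> \oo] --> ln E0.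
Proof.
move=> E0gt ub lb; apply/cvgrPdist_le => e e0.
have e2 : 0 < e / 2 by lra.
have h1 : 1 < expR (e / 2) by rewrite -[ltLHS]expR0 ltr_expR.
have h2 : expR (- (e / 2)) < 1 by rewrite -[ltRHS]expR0 ltr_expR oppr_lt0.
have [C C0 HC] := ub (E0 * expR (e / 2)) ltac:(by rewrite ltr_pMr).
have [c c0 Hc] := lb (E0 * expR (- (e / 2))) ltac:(by rewrite mulr_gt0 ?expR_gt0//= gtr_pMr).
(* From n = M on, the constants C and c change the normalised logarithm by at most e / 2. *)
have [M HM] : exists M : nat, `|ln C| + `|ln c| <= M%:R * (e / 2).
  exists (Num.bound ((`|ln C| + `|ln c|) / (e / 2))).
  have := archi_boundP (divr_ge0 (addr_ge0 (normr_ge0 (ln C)) (normr_ge0 (ln c))) (ltW e2)).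
  by rewrite ltr_pdivrMr// => /ltW.
near=> n.
have n0 : (0 < n)%N by near: n; exact: nbhs_infty_gt.
have nM : (M <= n)%N by near: n; exact: nbhs_infty_ge.
have nR : 0 < n%:R :> R by rewrite ltr0n.
have lnpow (K t : R) : 0 < K -> ln (K * (E0 * expR t) ^+ n) = ln K + n%:R * (ln E0 + t).
  move=> K0; rewrite lnM ?posrE ?exprn_gt0 ?mulr_gt0 ?expR_gt0//.
  by rewrite lnXn ?mulr_gt0 ?expR_gt0// lnM ?posrE ?expR_gt0// expRK mulr_natl.
have A0 : 0 < A n.
  by apply: lt_le_trans (Hc n n0); rewrite mulr_gt0// exprn_gt0// mulr_gt0 ?expR_gt0.
have U : ln (A n) <= ln C + n%:R * (ln E0 + e / 2).
  by rewrite -lnpow// ler_ln ?posrE ?HC// mulr_gt0// exprn_gt0// mulr_gt0 ?expR_gt0.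
have L : ln c + n%:R * (ln E0 - e / 2) <= ln (A n).
  by rewrite -lnpow// ler_ln ?posrE ?Hc// mulr_gt0// exprn_gt0// mulr_gt0 ?expR_gt0.
have Mn : M%:R * (e / 2) <= n%:R * (e / 2) by rewrite ler_wpM2r ?ler_nat// ltW.
have lC := ler_norm (ln C); have lc := ler_norm (- ln c); rewrite normrN in lc.
have lC0 := normr_ge0 (ln C); have lc0 := normr_ge0 (ln c).
rewrite -(ler_pM2l nR) -[X in X * `|_|](gtr0_norm nR) -normrM mulrBr mulrA divff ?gt_eqF// mul1r.
rewrite ler_norml; apply/andP; split; nra.
Unshelve. all: by end_near. Qed.

Section pressure_limit.
Context {R : realType} {d0 : measure_display} {T : measurableType d0}
  (P0 : probability T R) (D : {RV P0 >-> nat}).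
Variables beta B : R.
Hypothesis beta_ge0 : 0 <= beta.
Hypothesis D_gt0 : forall w, (0 < D w)%N.
Hypothesis exp_moment : ('E_P0[fun w => expR (beta * (D w)%:R / 2)] < +oo)%E.

Local Notation p := (degree_law D).
Local Notation h := (fun k : nat => expR (beta / 2 * k%:R)).

Lemma degree_law_ge0 k : 0 <= p k.
Proof. exact: fine_ge0. Qed.

Lemma degree_law0 : p 0%N = 0.
Proof.
rewrite /degree_law (_ : [set w | D w = 0%N] = set0) ?measure0//.
by apply/seteqP; split=> w //= Dw; have := D_gt0 w; rewrite Dw.
Qed.

Lemma degree_law_sum1 : (\sum_(k <oo) (p k * 1)%:E = 1)%E.
Proof.
rewrite -(expectation_nat D (fun=> ler01)) unlock integral_cst//.
by rewrite mul1e; exact: probability_setT.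
Qed.

Lemma exp_moment_sum : (\sum_(k <oo) (p k * h k)%:E =
  (fine (\sum_(k <oo) (p k * h k)%:E))%:E)%E.
Proof.
rewrite fineK// -(expectation_nat D (fun k => expR_ge0 (beta / 2 * k%:R))).
rewrite (_ : (fun w => _) = (fun w => expR (beta * (D w)%:R / 2))); last first.
  by apply/funext => w; rewrite mulrAC.
by rewrite ge0_fin_numE// unlock integral_ge0//.
Qed.

Lemma wt_dominated u v : u <= beta / 2 -> v <= beta / 2 -> dominated h (wt B u v).
Proof.
move=> ub vb; split; first by move=> k; rewrite ltW ?wt_gt0.
exists (expR B + expR (- B)) => k; rewrite /wt mulrDl !expRD lerD//.
  by rewrite ler_wpM2l ?expR_ge0// ler_expR ler_wpM2r.
by rewrite ler_wpM2l ?expR_ge0// ler_expR ler_wpM2r.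
Qed.

(** The function N of the overview; [mf_sup] is its supremum. *)
Definition mf_mass (x : R) : R := dmean p (wt B (lamp beta x) (lamm beta x)).

Lemma mf_dominated x : 0 <= x <= 1 -> dominated h (wt B (lamp beta x) (lamm beta x)).
Proof. by move=> x01; apply: wt_dominated; [exact: lamp_le|exact: lamm_le]. Qed.

Definition mf_sup : R := sup [set mf_mass x | x in `[0, 1]].

Let h_ge0 k : 0 <= h k. Proof. exact: expR_ge0. Qed.

Lemma mf_has_sup : has_sup [set mf_mass x | x in `[0, 1]].
Proof.
split; first by exists (mf_mass 0); exists 0 => //=; rewrite in_itv/= lexx ler01.
exists (dmean p (wt B (beta / 2) (beta / 2))) => y [x]; rewrite /= in_itv/= => x01 <-.
apply: (le_dmean degree_law_ge0 h_ge0 exp_moment_sum).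
- by move=> k; rewrite ltW ?wt_gt0.
- by move=> k; rewrite /wt lerD// ler_expR lerD2l ler_wpM2r//; [exact: lamp_le|exact: lamm_le].
- exact: wt_dominated.
Qed.

Lemma mf_mass_le_sup x : 0 <= x <= 1 -> mf_mass x <= mf_sup.
Proof.
move=> x01; apply: ub_le_sup; first by case: mf_has_sup.
by exists x => //=; rewrite in_itv.
Qed.

Lemma mf_sup_adherent r : r < mf_sup -> exists2 x, 0 <= x <= 1 & r < mf_mass x.
Proof.
move=> rs; have e0 : 0 < mf_sup - r by lra.
have [_ [x /= x01 <-]] := sup_adherent e0 mf_has_sup.
rewrite -/mf_sup subKr => H; exists x => //; by move: x01; rewrite in_itv.
Qed.

Lemma dominated1 : dominated h (fun=> 1).
Proof.
split=> //; exists 1 => k; rewrite mul1r -[leLHS]expR0 ler_expR mulr_ge0// divr_ge0//.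
Qed.

Lemma dmean1 : dmean p (fun=> 1) = 1.
Proof. by rewrite /dmean degree_law_sum1. Qed.

(* At x = 1/2 both rates equal beta/2 + F(1/2) >= 0. *)
Lemma mf_sup_ge : (expR B + expR (- B)) * expR (lamp beta (1 / 2)) <= mf_sup.
Proof.
have l0 : 0 <= lamp beta (1 / 2).
  have := beta_ge0; rewrite le_eqVlt => /predU1P[b0|/lamp_half_gt0/ltW//].
  by have := lamp_ge beta_ge0 (x := 1 / 2) ltac:(lra); rewrite -{1}b0 mulr0.
have x01 : 0 <= (1 / 2 : R) <= 1 by lra.
apply: le_trans (mf_mass_le_sup x01).
have lE : lamm beta (1 / 2) = lamp beta (1 / 2).
  by rewrite lamm_lamp//; congr lamp; lra.
rewrite /mf_mass lE; set l := lamp beta _ in l0 lE *.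
rewrite -[leLHS]mulr1 -dmean1.
rewrite -(dmeanZ degree_law_ge0 h_ge0 exp_moment_sum); last 2 first.
- by rewrite mulr_ge0 ?addr_ge0 ?expR_ge0.
- exact: dominated1.
rewrite -lee_fin -!(dmeanE degree_law_ge0 h_ge0 exp_moment_sum); last 2 first.
- by rewrite -{2}lE; exact: mf_dominated.
- apply: dominatedZ dominated1.
  by rewrite mulr_ge0 ?addr_ge0 ?expR_ge0.
apply: lee_nneseries => k _.
  by rewrite lee_fin mulr_ge0 ?degree_law_ge0// mulr1 mulr_ge0 ?addr_ge0 ?expR_ge0.
clearbody l; rewrite lee_fin; case: k => [|k]; first by rewrite degree_law0 !mul0r.
rewrite ler_wpM2l ?degree_law_ge0// mulr1 /wt !expRD -mulrDl.
apply: ler_wpM2l; first by rewrite addr_ge0 ?expR_ge0.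
by rewrite ler_expR ler_peMr// ler1n.
Qed.

Lemma mf_sup_gt0 : 0 < mf_sup.
Proof. by apply: lt_le_trans mf_sup_ge; rewrite mulr_gt0 ?addr_gt0 ?expR_gt0. Qed.

Section iid.
Context {d : measure_display} {Omega : measurableType d} (P : probability Omega R)
  (X : nat -> {RV P >-> nat}).
Hypothesis X_iid : iid_copies D X.

Local Notation Zan n := ('E_P[fun w => pairing_mean_Z
  (fix_parity (fun i : 'I_n => X i w)) beta B])%E.

Lemma integral_prod_wt n u v : u <= beta / 2 -> v <= beta / 2 ->
  (\int[P]_w (\prod_(i < n) wt B u v (X i w))%:E = (dmean p (wt B u v) ^+ n)%:E)%E.
Proof.
move=> ub vb; apply: (integral_prod_iid X_iid).
  by move=> k; rewrite ltW ?wt_gt0.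
by apply: (dmeanE degree_law_ge0 h_ge0 exp_moment_sum); exact: wt_dominated.
Qed.

Lemma measurable_prod_wt n u v :
  measurable_fun setT (EFin \o (fun w => \prod_(i < n) wt B u v (X i w) : R)).
Proof.
apply/measurable_EFinP.
exact: (measurable_comp_RVs X (fun k : 'I_n -> nat => \prod_(i < n) wt B u v (k i))).
Qed.

Lemma measurable_Z n : measurable_fun setT (EFin \o (fun w => pairing_mean_Z
  (fix_parity (fun i : 'I_n => X i w)) beta B)).
Proof.
apply/measurable_EFinP.
exact: (measurable_comp_RVs X (fun k : 'I_n -> nat => pairing_mean_Z (fix_parity k) beta B)).
Qed.

Lemma pairing_mean_Z_ge0 n (k : 'I_n -> nat) : 0 <= pairing_mean_Z k beta B.
Proof.
rewrite divr_ge0// sumr_ge0// => M _; rewrite sumr_ge0// => s _; exact: expR_ge0.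
Qed.

Lemma Zan_ge n x : (0 < n)%N -> 0 <= x <= 1 ->
  ((expR (- 6 * beta) * mf_mass x ^+ n)%:E <= Zan n)%E.
Proof.
move=> n0 x01; rewrite unlock.
rewrite EFinM -integral_prod_wt; [|exact: lamp_le|exact: lamm_le].
rewrite -ge0_integralZl//; last 2 first.
- exact: measurable_prod_wt.
- by move=> w _; rewrite lee_fin prodr_ge0// => i _; rewrite ltW ?wt_gt0.
apply: ge0_le_integral => //.
- move=> w _; rewrite -EFinM lee_fin mulr_ge0 ?expR_ge0// prodr_ge0// => i _.
  by rewrite ltW ?wt_gt0.
- apply: measurable_funeM; exact: measurable_prod_wt.
- exact: measurable_Z.
- by move=> w _; rewrite -EFinM lee_fin pairing_mean_Z_ge.
Qed.

Lemma Zan_le n (s : seq (R * R)) : (0 < n)%N ->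
  {in s, forall y, y.1 <= beta / 2 /\ y.2 <= beta / 2} ->
  (forall x, 0 <= x <= 1 ->
     exists2 y, y \in s & lamp beta x <= y.1 /\ lamm beta x <= y.2) ->
  (Zan n <= (expR (3 * beta) * \sum_(y <- s) dmean p (wt B y.1 y.2) ^+ n)%:E)%E.
Proof.
move=> n0 s_le s_cover; rewrite unlock.
rewrite EFinM -sumEFin.
rewrite big_seq
  (eq_bigr (fun y => \int[P]_w (\prod_(i < n) wt B y.1 y.2 (X i w))%:E)%E); last first.
  by move=> y /s_le[y1 y2]; rewrite integral_prod_wt.
rewrite -big_seq -ge0_integral_sum//; last 2 first.
- by move=> y; exact: measurable_prod_wt.
- by move=> y w _; rewrite lee_fin prodr_ge0// => i _; rewrite ltW ?wt_gt0.
have ms : measurable_fun setT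
    (fun w => \sum_(y <- s) (\prod_(i < n) wt B y.1 y.2 (X i w))%:E)%E.
  by apply: emeasurable_sum => y; exact: measurable_prod_wt.
rewrite -ge0_integralZl//; last first.
  move=> w _; rewrite sume_ge0// => y _; rewrite lee_fin prodr_ge0// => i _.
  by rewrite ltW ?wt_gt0.
apply: ge0_le_integral => //.
- by move=> w _; rewrite lee_fin pairing_mean_Z_ge0.
- exact: measurable_Z.
- exact: measurable_funeM.
- by move=> w _; rewrite sumEFin -EFinM lee_fin pairing_mean_Z_le.
Qed.

(** A capped rate M satisfies M - e <= t, so exp (M k) - exp (t k) is at most exp (M k) * (1 - exp
    (- e k)), and M <= beta / 2 replaces the first factor by [h k]. *)
Lemma wt_cap_le (e u v : R) k : 0 < e -> u <= beta / 2 -> v <= beta / 2 ->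
  wt B (Num.min (beta / 2) (u + e)) (Num.min (beta / 2) (v + e)) k <=
  wt B u v k + (expR B + expR (- B)) * (h k * (1 - expR (- e * k%:R))).
Proof.
move=> e0 ub vb.
have cap t : t <= beta / 2 -> expR (Num.min (beta / 2) (t + e) * k%:R) <=
    expR (t * k%:R) + h k * (1 - expR (- e * k%:R)).
  move=> tb; set M := Num.min _ _.
  have M1 : M <= beta / 2 by rewrite ge_min lexx.
  have M2 : M <= t + e by rewrite ge_min lexx orbT.
  have e1 : expR (M * k%:R) * expR (- e * k%:R) <= expR (t * k%:R).
    by rewrite -expRD -mulrDl ler_expR ler_wpM2r//; lra.
  have e2 : expR (- e * k%:R) <= 1.
    by rewrite -[leRHS]expR0 ler_expR mulNr oppr_le0 mulr_ge0// ltW.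
  have e3 : expR (M * k%:R) * (1 - expR (- e * k%:R)) <= h k * (1 - expR (- e * k%:R)).
    by rewrite ler_wpM2r ?subr_ge0// ler_expR ler_wpM2r.
  lra.
have := ler_wpM2l (expR_ge0 B) (cap u ub).
have := ler_wpM2l (expR_ge0 (- B)) (cap v vb).
rewrite /wt !expRD; lra.
Qed.

Lemma Zan_upper r : mf_sup < r ->
  exists2 C, 0 < C & forall n, (0 < n)%N -> (Zan n <= (C * r ^+ n)%:E)%E.
Proof.
move=> rs; have b0 := beta_ge0.
have c0 : 0 < expR B + expR (- B) by rewrite addr_gt0 ?expR_gt0.
(* The loss from capping, multiplied by exp B + exp (- B), has to fit into r - [mf_sup]. *)
have e0 : 0 < (r - mf_sup) / (expR B + expR (- B)) by rewrite divr_gt0//; lra.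
have [e egt He] := dmean_left_cont degree_law_ge0 h_ge0 exp_moment_sum e0.
have dFb (x : R) : `[0, 1]%classic x -> - 2 * beta <= dF beta x <= 2 * beta.
  by rewrite /= in_itv/= => x01; exact: dF_bounds.
have [xs [xs01 xsc]] := finite_value_net egt dFb.
pose cap t := Num.min (beta / 2) (t + e).
pose s := [seq (cap (lamp beta x), cap (lamm beta x)) | x <- xs].
have cap_le t : cap t <= beta / 2 by rewrite ge_min lexx.
exists (expR (3 * beta) * ((size s)%:R + 1)).
  by rewrite mulr_gt0 ?expR_gt0// ltr_wpDl.
move=> n n0; apply: le_trans (@Zan_le n s n0 _ _) _.
- by move=> _ /mapP[x _ ->]; split; exact: cap_le.
(* At x each rate is at most e above the one at the net point y, and at most beta / 2 in any case,
   hence below the capped rate. *)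
- move=> x x01; have [|y ys xy] := xsc x; first by rewrite /= in_itv.
  have y01 : 0 <= y <= 1 by have := xs01 _ ys; rewrite /= in_itv.
  exists (cap (lamp beta y), cap (lamm beta y)); first by apply/mapP; exists y.
  rewrite /cap !le_min lamp_le// lamm_le//=.
  have := lamp_lip b0 x01 y01; have := lamm_lip b0 x01 y01; lra.
rewrite lee_fin -mulrA ler_wpM2l ?expR_ge0//.
have r0 : 0 <= r by apply: ltW; apply: lt_trans rs; exact: mf_sup_gt0.
apply: (@le_trans _ _ (\sum_(y <- s) r ^+ n)); last first.
  rewrite big_const_seq count_predT iter_addr addr0 -[leLHS]mulr_natl.
  by rewrite ler_wpM2r ?exprn_ge0// lerDl.
rewrite big_map [leRHS]big_map big_seq [leRHS]big_seq ler_sum// => x xxs.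
have x01 : 0 <= x <= 1 by have := xs01 _ xxs; rewrite /= in_itv.
have lp := lamp_le b0 x01; have lm := lamm_le b0 x01.
have dz : dominated h (fun k => h k * (1 - expR (- e * k%:R))).
  apply: (@dominated_le _ h) (dominated_h h_ge0).
    move=> k; rewrite mulr_ge0// subr_ge0 -[leRHS]expR0 ler_expR mulNr oppr_le0.
    by rewrite mulr_ge0// ltW.
  by move=> k; rewrite ler_piMr// gerBl expR_ge0.
have dcz := dominatedZ (ltW c0) dz.
rewrite lerXn2r// ?nnegrE//.
  have := le_dmean degree_law_ge0 h_ge0 exp_moment_sum (phi := fun=> 0)
    (psi := wt B (cap (lamp beta x)) (cap (lamm beta x))).
  rewrite {1}/dmean; under eq_eseriesr do rewrite mulr0.
  rewrite eseries0//= => -> //; last exact: wt_dominated.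
  by move=> k; rewrite ltW ?wt_gt0.
apply: (@le_trans _ _ (mf_mass x + (expR B + expR (- B)) *
   dmean p (fun k => h k * (1 - expR (- e * k%:R))))).
  rewrite -(dmeanZ degree_law_ge0 h_ge0 exp_moment_sum (ltW c0) dz).
  rewrite -(dmeanD degree_law_ge0 h_ge0 exp_moment_sum (mf_dominated x01) dcz).
  apply: (le_dmean degree_law_ge0 h_ge0 exp_moment_sum).
  - by move=> k; rewrite ltW ?wt_gt0.
  - by move=> k; exact: wt_cap_le.
  - apply: (dominatedD) dcz; exact: mf_dominated.
have := mf_mass_le_sup x01.
have := He; rewrite ler_pdivlMr//; lra.
Qed.

Lemma pressure_cvg : annealed_pressure X beta B n @[n --> \oo] --> (ln mf_sup)%:E.
Proof.
have Zfin n : (0 < n)%N -> Zan n = (fine (Zan n))%:E.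
  move=> n0; rewrite fineK// ge0_fin_numE; last first.
    by rewrite unlock integral_ge0// => w _; rewrite lee_fin pairing_mean_Z_ge0.
  have [C C0 HC] := @Zan_upper (mf_sup + 1) ltac:(lra).
  exact: le_lt_trans (HC n n0) (ltry _).
pose A n := fine (Zan n).
have lbnd r : 0 < r < mf_sup -> exists2 C, 0 < C & forall n, (0 < n)%N -> C * r ^+ n <= A n.
  move=> /andP[r0 rs]; have [x x01 rx] := mf_sup_adherent rs.
  exists (expR (- 6 * beta)); first exact: expR_gt0.
  move=> n n0; rewrite -lee_fin /A -Zfin//; apply: le_trans (Zan_ge n0 x01).
  rewrite lee_fin ler_wpM2l ?expR_ge0// lerXn2r ?nnegrE// ltW//.
  exact: lt_trans rx.
have ubnd r : mf_sup < r -> exists2 C, 0 < C & forall n, (0 < n)%N -> A n <= C * r ^+ n.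
  move=> /Zan_upper[C C0 HC]; exists C => // n n0.
  by rewrite -lee_fin /A -Zfin// HC.
have lim := growth_rate_cvg mf_sup_gt0 ubnd lbnd.
have lime : (n%:R^-1 * ln (A n))%:E @[n --> \oo] --> (ln mf_sup)%:E.
  exact: (cvg_comp _ _ lim).
apply: cvg_trans lime; apply: near_eq_cvg; near=> n.
have n0 : (0 < n)%N by near: n; exact: nbhs_infty_gt.
have A0 : 0 < A n.
  have s0 := mf_sup_gt0.
  have [C C0 HC] := lbnd (mf_sup / 2) ltac:(lra).
  by apply: lt_le_trans (HC n n0); rewrite mulr_gt0// exprn_gt0//; lra.
by rewrite /annealed_pressure Zfin// lne_EFin// EFinM.
Unshelve. all: by end_near. Qed.

End iid.
End pressure_limit.

(** * The variational formula *)

Section summable_series.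
Context {R : realType}.
Implicit Types u v : nat -> R.

(** An infinite real sum is a limit that defaults when there is none; summability makes it a true
    limit, so that inequalities pass from partial sums. *)
Lemma nnseries_cvg u : (forall k, 0 <= u k) ->
  (\sum_(1 <= k <oo) (u k)%:E < +oo)%E ->
  \sum_(1 <= k < n) u k @[n --> \oo] --> \big[+%R/0]_(1 <= k <oo) u k.
Proof.
move=> u0 uoo.
have c : (\sum_(1 <= k < n) (u k)%:E)%E @[n --> \oo] -->
    (fine (\sum_(1 <= k <oo) (u k)%:E))%:E.
  rewrite fineK; first by apply: is_cvg_nneseries => k _ _; rewrite lee_fin.
  by rewrite ge0_fin_numE// nneseries_ge0// => k _ _; rewrite lee_fin.
have {}c : \sum_(1 <= k < n) u k @[n --> \oo] --> fine (\sum_(1 <= k <oo) (u k)%:E)%E.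
  move: c => /fine_cvgP[_]; apply: cvg_trans; apply: near_eq_cvg; near=> n.
  by rewrite /= sumEFin.
by rewrite (cvg_lim _ c).
Unshelve. all: by end_near. Qed.

Lemma nnseries_cvg_le u v : (forall k, 0 <= u k) -> (forall k, u k <= v k) ->
  (\sum_(1 <= k <oo) (v k)%:E < +oo)%E ->
  \sum_(1 <= k < n) u k @[n --> \oo] --> \big[+%R/0]_(1 <= k <oo) u k.
Proof.
move=> u0 uv voo; apply: nnseries_cvg => //; apply: le_lt_trans voo.
by apply: lee_nneseries => k _; rewrite lee_fin.
Qed.

End summable_series.

(** * Gibbs' variational principle for one spin *)

Section gibbs.
Context {R : realType}.
Implicit Types (a b t : R).

Lemma ln_le_subr1 (y : R) : 0 < y -> ln y <= y - 1.
Proof.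
by move=> y0; have := expR_ge1Dx (ln y); rewrite lnK ?posrE//; lra.
Qed.

Lemma entropy_ge0 t : 0 < t < 1 -> 0 <= binary_entropy t.
Proof.
move=> /andP[t0 t1]; rewrite /binary_entropy.
have h1 : 0 <= t * - ln t by rewrite mulr_ge0 ?oppr_ge0 ?ln_le0// ltW.
have h2 : 0 <= (1 - t) * - ln (1 - t).
  by rewrite mulr_ge0 ?subr_ge0 ?oppr_ge0 ?ln_le0 ?(ltW t1)// gerBl ltW.
lra.
Qed.

Lemma entropy_le1 t : 0 < t < 1 -> binary_entropy t <= 1.
Proof.
move=> /andP[t0 t1]; rewrite /binary_entropy.
have key (y : R) : 0 < y -> - y * ln y <= 1 - y.
  move=> y0; have := ln_le_subr1 (y := y^-1); rewrite invr_gt0 => /(_ y0).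
  rewrite lnV ?posrE// -(ler_pM2l y0) mulrBr divff ?gt_eqF//; lra.
have := key t t0; have := key (1 - t) ltac:(lra); lra.
Qed.

(** Nonnegativity of the relative entropy of (t, 1 - t) with respect to the Gibbs weights, obtained
    from ln y <= y - 1 at each of the two points. *)
Lemma gibbs_two_point t a b : 0 < t < 1 ->
  binary_entropy t + t * a + (1 - t) * b <= ln (expR a + expR b).
Proof.
move=> /andP[t0 t1]; set W := expR a + expR b.
have W0 : 0 < W by rewrite addr_gt0 ?expR_gt0.
have key (y z : R) : 0 < y -> y * (z - ln y - ln W) <= expR z / W - y.
  move=> y0; have : 0 < expR z / (y * W) by rewrite divr_gt0 ?expR_gt0// mulr_gt0.
  move/ln_le_subr1; rewrite ln_div ?posrE ?expR_gt0 ?mulr_gt0// expRK lnM ?posrE//.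
  rewrite -(ler_pM2l y0).
  have -> : y * (expR z / (y * W) - 1) = expR z / W - y by field; rewrite ?gt_eqF.
  by rewrite opprD addrA.
have k1 := key t a t0; have k2 := key (1 - t) b ltac:(lra).
have : expR a / W + expR b / W = 1 by rewrite -mulrDl divff// gt_eqF.
rewrite /binary_entropy; lra.
Qed.

Lemma gibbs_two_point_eq a b (t := expR a / (expR a + expR b)) :
  0 < t < 1 /\ binary_entropy t + t * a + (1 - t) * b = ln (expR a + expR b).
Proof.
set W := expR a + expR b in t *.
have W0 : 0 < W by rewrite addr_gt0 ?expR_gt0.
have t1E : 1 - t = expR b / W.
  by rewrite /t -[1](divff (lt0r_neq0 W0)) -mulrBl /W addrAC subrr add0r.
split.
  rewrite divr_gt0 ?expR_gt0//= -subr_gt0 t1E divr_gt0 ?expR_gt0//.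
rewrite /binary_entropy t1E /t !ln_div ?posrE ?expR_gt0// !expRK.
have : expR a / W + expR b / W = 1 by rewrite -mulrDl divff// gt_eqF.
set u := expR a / W; set v := expR b / W => uv.
have -> : v = 1 - u by lra.
ring.
Qed.

End gibbs.

Section functional.
Context {R : realType}.
Variables beta B : R.
Hypothesis beta_ge0 : 0 <= beta.
Variables (q s : nat -> R).
Hypothesis q_distr : is_distr q.
Hypothesis q_mean : finite_mean q.
Hypothesis s01 : forall k, 0 < s k < 1.

Local Notation mp := (\big[+%R/0]_(1 <= k <oo) (k%:R * q k * s k)).
Local Notation lp := (lamp beta).
Local Notation lm := (lamm beta).

(** The share of degree k in the deterministic-degree functional once the pairing term is replaced
    by its linear form at x. *)
Definition tilted_term x k : R :=
  q k * (binary_entropy (s k) + s k * (B + lp x * k%:R) + (1 - s k) * (- B + lm x * k%:R)).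

Let q0 k : 0 <= q k. Proof. by case: q_distr. Qed.

Let q_lty : (\sum_(1 <= k <oo) (q k)%:E < +oo)%E.
Proof. by case: q_distr => _ _ ->; rewrite ltry. Qed.

Lemma distr_sum_cvg : \sum_(1 <= k < n) q k @[n --> \oo] --> (1 : R).
Proof.
have := nnseries_cvg q0 q_lty; suff -> : \big[+%R/0]_(1 <= k <oo) q k = 1 by [].
have [_ _ q1] := q_distr.
have c : (\sum_(1 <= k < n) (q k)%:E)%E @[n --> \oo] --> (1 : R)%:E.
  by rewrite -[(1 : R)%:E]q1; apply: is_cvg_nneseries => k _ _; rewrite lee_fin.
have {}c : \sum_(1 <= k < n) q k @[n --> \oo] --> (1 : R).
  move: c => /fine_cvgP[_]; apply: cvg_trans; apply: near_eq_cvg; near=> n.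
  by rewrite /= sumEFin.
by rewrite (cvg_lim _ c).
Unshelve. all: by end_near. Qed.

Lemma mean_cvg : \sum_(1 <= k < n) k%:R * q k @[n --> \oo] --> mean q.
Proof. by apply: nnseries_cvg => // k; rewrite mulr_ge0. Qed.

Let mp_cvg : \sum_(1 <= k < n) k%:R * q k * s k @[n --> \oo] --> mp.
Proof.
apply: (nnseries_cvg_le (v := fun k => k%:R * q k)) => // k.
  by rewrite !mulr_ge0// ltW; case/andP: (s01 k).
by rewrite ler_piMr ?mulr_ge0// ltW; case/andP: (s01 k).
Qed.

Lemma tilted_cvg x : \sum_(1 <= k < n) tilted_term x k @[n --> \oo] -->
  \big[+%R/0]_(1 <= k <oo) (q k * binary_entropy (s k))
  + B * (2 * \big[+%R/0]_(1 <= k <oo) (s k * q k) - 1)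
  + (lp x * mp + lm x * (mean q - mp)).
Proof.
have c1 : \sum_(1 <= k < n) q k * binary_entropy (s k) @[n --> \oo] -->
    \big[+%R/0]_(1 <= k <oo) (q k * binary_entropy (s k)).
  apply: (nnseries_cvg_le (v := q)) => // k; first by rewrite mulr_ge0 ?entropy_ge0.
  by rewrite ler_piMr ?entropy_le1.
have c2 : \sum_(1 <= k < n) s k * q k @[n --> \oo] -->
    \big[+%R/0]_(1 <= k <oo) (s k * q k).
  apply: (nnseries_cvg_le (v := q)) => // k.
    by rewrite mulr_ge0 ?q0// ltW; case/andP: (s01 k).
  by rewrite ler_piMl ?q0// ltW; case/andP: (s01 k).
have -> : (fun n => \sum_(1 <= k < n) tilted_term x k) = (fun n =>
   \sum_(1 <= k < n) q k * binary_entropy (s k)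
   + B * (2 * (\sum_(1 <= k < n) s k * q k) - \sum_(1 <= k < n) q k)
   + (lp x * (\sum_(1 <= k < n) k%:R * q k * s k)
      + lm x * (\sum_(1 <= k < n) k%:R * q k - \sum_(1 <= k < n) k%:R * q k * s k))).
  apply/funext => n; rewrite !mulr_sumr -!sumrB !mulr_sumr -!big_split/=.
  by apply: eq_bigr => k _; rewrite /tilted_term; ring.
apply: cvgD.
  apply: cvgD => //; apply: cvgM; first exact: cvg_cst.
  apply: cvgB; last exact: distr_sum_cvg.
  by apply: cvgM => //; exact: cvg_cst.
apply: cvgD; first by apply: cvgM => //; exact: cvg_cst.
apply: cvgM; first exact: cvg_cst.
by apply: cvgB => //; exact: mean_cvg.
Qed.

Lemma mean_ge1 : 1 <= mean q.
Proof.
apply: (ler_cvg_to distr_sum_cvg mean_cvg); near=> n.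
apply: ler_sum_nat => k /andP[k1 _]; rewrite ler_peMl// ler1n.
by [].
Unshelve. all: by end_near. Qed.

Let mp01 : 0 <= mp / mean q <= 1.
Proof.
have m1 := mean_ge1; have m0 : 0 < mean q by lra.
apply/andP; split.
  rewrite divr_ge0 ?(ltW m0)//.
  apply: (ler_cvg_to (@cvg_cst _ (0 : R) _ _ _) mp_cvg); near=> n.
  by apply: sumr_ge0 => k _; rewrite !mulr_ge0// ltW; case/andP: (s01 k).
rewrite ler_pdivrMr// mul1r.
apply: (ler_cvg_to mp_cvg mean_cvg); near=> n.
by apply: ler_sum => k _; rewrite ler_piMr ?mulr_ge0// ltW; case/andP: (s01 k).
Unshelve. all: by end_near. Qed.

Let mp_split x : let y := mp / mean q in
  lp x * mp + lm x * (mean q - mp) = mean q * (y * lp x + (1 - y) * lm x).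
Proof.
move=> y; have m1 := mean_ge1; have m0 : mean q != 0 by rewrite gt_eqF//; lra.
by rewrite /y; field.
Qed.

(** The witness is the fraction of half-edges at + vertices under q and s: there the linear form
    agrees with the pairing term by Euler's identity. *)
Lemma functional_cvg : exists2 x, 0 <= x <= 1 &
  \sum_(1 <= k < n) tilted_term x k @[n --> \oo] -->
    beta * mean q / 2 + phi_functional beta B q s.
Proof.
exists (mp / mean q) => //.
suff -> : beta * mean q / 2 + phi_functional beta B q s =
  \big[+%R/0]_(1 <= k <oo) (q k * binary_entropy (s k))
  + B * (2 * \big[+%R/0]_(1 <= k <oo) (s k * q k) - 1)
  + (lp (mp / mean q) * mp + lm (mp / mean q) * (mean q - mp)) by exact: tilted_cvg.
by rewrite mp_split lam_euler /phi_functional; ring.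
Qed.

(** At any other x the linear form is only a lower bound, by convexity. *)
Lemma functional_ge x (V : R) : 0 <= x <= 1 ->
  \sum_(1 <= k < n) tilted_term x k @[n --> \oo] --> V ->
  V <= beta * mean q / 2 + phi_functional beta B q s.
Proof.
move=> x01 cV; have := cvg_lim (@Rhausdorff R) cV.
rewrite (cvg_lim (@Rhausdorff R) (tilted_cvg (x := x))) => <-.
rewrite mp_split /phi_functional.
have := lam_support beta_ge0 mp01 x01.
rewrite -(ler_pM2l (_ : 0 < mean q)); last by have := mean_ge1; lra.
lra.
Qed.

Lemma tilted_term_le x k : tilted_term x k <= q k * ln (wt B (lp x) (lm x) k).
Proof. by rewrite /tilted_term ler_wpM2l// gibbs_two_point. Qed.

End functional.

Section entropy_series.
Context {R : realType}.
Variables q p : nat -> R.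
Hypothesis q_distr : is_distr q.
Hypothesis p_distr : is_distr p.

Definition entropy_term (k : nat) : \bar R :=
  (if q k == 0%R then 0
   else if p k == 0%R then +oo
   else (q k * ln (q k / p k))%:E)%E.

Let q0 k : 0 <= q k. Proof. by case: q_distr. Qed.
Let p0 k : 0 <= p k. Proof. by case: p_distr. Qed.

(** The inequality ln y <= y - 1 at y = p k * W / q k: entropy pays for any change of weight W, up
    to its mean under p. Applied below with W = [w x k / E]. *)
Lemma entropy_term_ge k W : 0 < W ->
  ((q k * ln W - p k * W + q k)%:E <= entropy_term k)%E.
Proof.
move=> W0; rewrite /entropy_term; case: eqP => [->|/eqP qn0].
  by rewrite mul0r addr0 sub0r lee_fin oppr_le0 mulr_ge0 ?p0// ltW.
case: eqP => [_|/eqP pn0]; first exact: leey.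
have q_gt0 : 0 < q k by rewrite lt_neqAle eq_sym qn0 q0.
have p_gt0 : 0 < p k by rewrite lt_neqAle eq_sym pn0 p0.
rewrite lee_fin.
have : 0 < p k * W / q k by rewrite divr_gt0// mulr_gt0.
move=> /ln_le_subr1 /(ler_wpM2l (ltW q_gt0)).
have -> : q k * (p k * W / q k - 1) = p k * W - q k by field.
rewrite ln_div ?posrE ?mulr_gt0// lnM ?posrE// [ln (q k / p k)]ln_div ?posrE//.
lra.
Qed.

Lemma entropy_term_geB k : ((q k - p k)%:E <= entropy_term k)%E.
Proof.
by have := @entropy_term_ge k 1 ltr01; rewrite ln1 mulr0 mulr1 add0r addrC.
Qed.

(** The terms may have either sign, but become nonnegative when q - p is subtracted, and the partial
    sums of q - p tend to 0. *)
Lemma entropy_cvg : cvgn (fun n => \sum_(1 <= k < n) entropy_term k)%E.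
Proof.
pose a k := (entropy_term k - (q k - p k)%:E)%E.
have a0 k : (0 <= a k)%E by rewrite sube_ge0// entropy_term_geB.
have aE k : entropy_term k = (a k + (q k - p k)%:E)%E by rewrite subeK.
have ca : cvgn (fun n => \sum_(1 <= k < n) a k)%E.
  by apply: is_cvg_nneseries => k _ _.
have cqp : (\sum_(1 <= k < n) (q k - p k)%:E)%E @[n --> \oo] --> ((1 : R) - 1)%:E.
  under eq_fun do rewrite sumEFin sumrB.
  apply: cvg_EFin; first by apply: nearW.
  by apply: cvgB; exact: distr_sum_cvg.
have -> : (fun n => \sum_(1 <= k < n) entropy_term k)%E =
    (fun n => \sum_(1 <= k < n) a k + \sum_(1 <= k < n) (q k - p k)%:E)%E.
  by apply/funext => n; rewrite -big_split/=; apply: eq_bigr => k _; rewrite aE.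
apply/cvg_ex; exists (limn (fun n => \sum_(1 <= k < n) a k) + (1 - 1)%:E)%E.
by apply: cvgeD => //; rewrite fin_num_adde_defl.
Qed.

End entropy_series.

Section variational.
Context {R : realType} {d0 : measure_display} {T : measurableType d0}
  (P0 : probability T R) (D : {RV P0 >-> nat}).
Variables beta B : R.
Hypothesis beta_ge0 : 0 <= beta.
Hypothesis D_gt0 : forall w, (0 < D w)%N.
Hypothesis exp_moment : ('E_P0[fun w => expR (beta * (D w)%:R / 2)] < +oo)%E.

Local Notation p := (degree_law D).
Local Notation h := (fun k : nat => expR (beta / 2 * k%:R)).
Local Notation E := (mf_sup D beta B).
Local Notation w x := (wt B (lamp beta x) (lamm beta x)).

Let E_gt0 : 0 < E. Proof. exact: mf_sup_gt0. Qed.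
Let p_ge0 k : 0 <= p k. Proof. exact: degree_law_ge0. Qed.
Let h_ge0 k : 0 <= h k. Proof. exact: expR_ge0. Qed.

Lemma degree_law_distr : is_distr p.
Proof.
split; [exact: degree_law0|exact: degree_law_ge0|].
have := degree_law_sum1 D; under eq_eseriesr do rewrite mulr1.
rewrite nneseries_recl//; last by move=> k _; rewrite lee_fin p_ge0.
by rewrite degree_law0// add0e.
Qed.

Lemma mf_partial_le x n : 0 <= x <= 1 -> \sum_(1 <= k < n) p k * w x k <= E.
Proof.
move=> x01; apply: le_trans (mf_mass_le_sup B beta_ge0 exp_moment x01).
apply: le_trans (dmean_ge_sum p_ge0 h_ge0 (exp_moment_sum exp_moment) n
  (mf_dominated B beta_ge0 x01)).
case: n => [|n]; first by rewrite big_geq// big_ord0.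
rewrite -(big_mkord xpredT (fun k => p k * w x k)) big_ltn// ler_wpDl//.
by rewrite mulr_ge0// ltW ?wt_gt0.
Qed.

Lemma functional_le_entropy q s : is_distr q -> finite_mean q ->
  (forall k, 0 < s k < 1) ->
  ((beta * mean q / 2 + phi_functional beta B q s - ln E)%:E <= relative_entropy q p)%E.
Proof.
move=> qd qm s01; have [x x01 cT] := functional_cvg beta B qd qm s01.
have q0 k : 0 <= q k by case: qd.
set L := _ + phi_functional _ _ _ _ in cT *.
have cS := entropy_cvg qd degree_law_distr.
(* The sum of [entropy_term_ge] with W = [w x k / E], after bounding the p-mean of W by 1; that 1
   cancels against the total mass of q in the limit. *)
pose u n := \sum_(1 <= k < n) tilted_term beta B q s x k -
   (ln E * (\sum_(1 <= k < n) q k) + 1 - \sum_(1 <= k < n) q k).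
have cu : u n @[n --> \oo] --> L - ln E.
  rewrite [L - ln E](_ : _ = L - (ln E * 1 + 1 - 1)); last by ring.
  apply: cvgB => //; apply: cvgB; last exact: distr_sum_cvg.
  apply: cvgD; last exact: cvg_cst.
  by apply: cvgM; [exact: cvg_cst|exact: distr_sum_cvg].
have cuE : (u n)%:E @[n --> \oo] --> (L - ln E)%:E.
  by apply: cvg_EFin => //; exact: nearW.
rewrite -(cvg_lim _ cuE)//; apply: lee_lim => //; first by apply/cvg_ex; exists (L - ln E)%:E.
apply: nearW => n.
apply: (@le_trans _ _ (\sum_(1 <= k < n)
    (q k * ln (w x k / E) - p k * (w x k / E) + q k)%:E)%E).
  rewrite sumEFin lee_fin big_split/= sumrB /u.
  have -> : \sum_(1 <= k < n) q k * ln (w x k / E) =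
     \sum_(1 <= k < n) q k * ln (w x k) - ln E * (\sum_(1 <= k < n) q k).
    rewrite mulr_sumr -sumrB; apply: eq_bigr => k _.
    by rewrite ln_div ?posrE ?wt_gt0//; ring.
  have -> : \sum_(1 <= k < n) p k * (w x k / E) = (\sum_(1 <= k < n) p k * w x k) / E.
    by rewrite mulr_suml; apply: eq_bigr => k _; rewrite mulrA.
  have h1 : (\sum_(1 <= k < n) p k * w x k) / E <= 1.
    by rewrite ler_pdivrMr// mul1r mf_partial_le.
  have h2 : \sum_(1 <= k < n) tilted_term beta B q s x k <=
     \sum_(1 <= k < n) q k * ln (w x k).
    by apply: ler_sum => k _; exact: tilted_term_le.
  lra.
apply: lee_sum => k _; apply: (entropy_term_ge qd degree_law_distr).
by rewrite divr_gt0 ?wt_gt0.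
Qed.

Lemma phi_and_sub_entropy_le q : is_distr q -> finite_mean q ->
  (phi_and beta B q - relative_entropy q p <= (ln E)%:E)%E.
Proof.
move=> qd qm.
have key (s : nat -> R) (s01 : forall k, 0 < s k < 1) := functional_le_entropy qd qm s01.
have half01 (k : nat) : 0 < (1 / 2 : R) < 1 by lra.
(* A single admissible s excludes relative entropy -oo, for which the difference to be bounded would
   be +oo. *)
have := key (fun=> 1 / 2) half01; clear half01.
case: (relative_entropy q p) key => [H| |] key => [_|_|//]; last by rewrite /= addeNy leNye.
rewrite leeBlDr// /phi_and -leeBrDl// -!EFinD.
apply: ge_ereal_sup => _ [s s01 <-]; have := key s s01.
rewrite !lee_fin; lra.
Qed.

Lemma phi_anD_le : (phi_anD beta B p <= (ln E)%:E)%E.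
Proof.
by apply: ge_ereal_sup => _ [q [qd qm] <-]; exact: phi_and_sub_entropy_le.
Qed.

(** Under the assumed moment the full tilted law p * w x / N x may have infinite mean, hence the
    truncation at n. With s the Gibbs weights at each degree, functional minus entropy is at least
    ln S, where S is the truncated mass. *)
Lemma phi_anD_ge_mass x r : 0 <= x <= 1 -> 0 < r -> r < mf_mass D beta B x ->
  ((ln r)%:E <= phi_anD beta B p)%E.
Proof.
move=> x01 r0 rx.
have cw := dmean_sum_cvg p_ge0 h_ge0 (exp_moment_sum exp_moment)
  (mf_dominated B beta_ge0 x01).
have [n Hn] : exists n, r < \sum_(k < n) p k * w x k.
  have : \forall n \near \oo, r < \sum_(k < n) p k * w x k by apply: (cvgr_gt _ cw).
  by move=> [n _ Hn]; exists n; apply: Hn => /=.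
set S := \sum_(k < n) _ in Hn.
have S0 : 0 < S by exact: lt_trans Hn.
pose q k := if (k < n)%N then p k * w x k / S else 0.
pose a k := B + lamp beta x * k%:R.
pose b k := - B + lamm beta x * k%:R.
pose s k := expR (a k) / (expR (a k) + expR (b k)).
have s01 k : 0 < s k < 1 by have [] := gibbs_two_point_eq (a k) (b k).
have q0 k : 0 <= q k.
  by rewrite /q; case: ifP => // _; rewrite divr_ge0 ?(ltW S0)// mulr_ge0// ltW ?wt_gt0.
have qz : q 0%N = 0 by rewrite /q degree_law0// !mul0r; case: ifP.
have sum_cut (f : nat -> R) (N : nat) : (n <= N)%N -> (forall k, (n <= k)%N -> f k = 0) ->
    \sum_(1 <= k < N) f k = \sum_(1 <= k < n) f k.
  move=> nN f0; have [n1|n1] := leqP 1 n.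
    rewrite (big_cat_nat n1 nN)/= [X in _ + X]big_nat_cond [X in _ + X]big1 ?addr0//.
    by move=> k /andP[/andP[nk _] _]; exact: f0.
  rewrite [RHS]big_geq; last by lia.
  rewrite big_nat_cond big1// => k /andP[/andP[k1 _] _]; apply: f0; lia.
have cut_cvg (f : nat -> R) : (forall k, (n <= k)%N -> f k = 0) ->
    \sum_(1 <= k < N) f k @[N --> \oo] --> \sum_(1 <= k < n) f k.
  move=> f0; apply: cvg_near_cst; near=> N; apply/eqP; rewrite sum_cut//.
  by near: N; exact: nbhs_infty_ge.
have cut_cvgE (f : nat -> R) : (forall k, (n <= k)%N -> f k = 0) ->
    (\sum_(1 <= k <oo) (f k)%:E = (\sum_(1 <= k < n) f k)%:E)%E.
  move=> f0; apply: cvg_lim => //.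
  under eq_fun do rewrite sumEFin.
  by apply: cvg_EFin; [exact: nearW|exact: cut_cvg].
have qn k : (n <= k)%N -> q k = 0 by rewrite /q ltnNge => ->.
have sumq : \sum_(1 <= k < n) q k = 1.
  have -> : \sum_(1 <= k < n) q k = (\sum_(1 <= k < n) p k * w x k) / S.
    rewrite mulr_suml; apply: eq_big_nat => k /andP[_ kn].
    by rewrite /q kn.
  suff -> : \sum_(1 <= k < n) p k * w x k = S by rewrite divff// gt_eqF.
  rewrite /S -(big_mkord xpredT (fun k => p k * w x k)).
  case: (n) => [|n']; first by rewrite !big_geq.
  by rewrite [RHS]big_ltn// degree_law0// mul0r add0r.
have qd : is_distr q by split=> //; rewrite cut_cvgE// sumq.
have qm : finite_mean q.
  by rewrite /finite_mean cut_cvgE ?ltry// => k nk; rewrite qn// mulr0.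
pose V := \sum_(1 <= k < n) q k * ln (w x k).
have L_ge : V <= beta * mean q / 2 + phi_functional beta B q s.
  apply: (functional_ge beta_ge0 qd qm s01 x01).
  have tE k : tilted_term beta B q s x k = q k * ln (w x k).
    by rewrite /tilted_term; have [_ ->] := gibbs_two_point_eq (a k) (b k).
  under eq_fun do under eq_bigr do rewrite tE.
  by apply: cut_cvg => k nk; rewrite qn// mul0r.
have HE : relative_entropy q p = (V - ln S)%:E.
  transitivity (\sum_(1 <= k <oo) (q k * ln (w x k) - q k * ln S)%:E)%E.
    apply: eq_eseriesr => k _; case: eqP => [->|/eqP qk0].
      by rewrite !mul0r subrr.
    have kn : (k < n)%N by rewrite ltnNge; apply: contra qk0 => /qn ->.
    have pk0 : p k != 0.
      by apply: contra qk0 => /eqP pk; rewrite /q kn pk !mul0r.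
    have pk : 0 < p k by rewrite lt_neqAle eq_sym pk0 p_ge0.
    rewrite (negbTE pk0) -mulrBr -ln_div ?posrE ?wt_gt0//; congr (_ * ln _)%:E.
    by rewrite /q kn; field; rewrite gt_eqF//= pk0.
  rewrite cut_cvgE; last by move=> k nk; rewrite qn// !mul0r subrr.
  by rewrite sumrB -mulr_suml sumq mul1r.
apply: (@le_trans _ _ (phi_and beta B q - relative_entropy q p)%E); last first.
  by apply: ereal_sup_ubound; exists q.
rewrite HE leeBrDr// -EFinD.
apply: (@le_trans _ _ (beta * mean q / 2 + phi_functional beta B q s)%:E).
  rewrite lee_fin; apply: le_trans L_ge.
  have : ln r <= ln S by rewrite ler_ln ?posrE// ltW.
  lra.
rewrite EFinD /phi_and leeD2l//; apply: ereal_sup_ubound.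
by exists s.
Unshelve. all: by end_near. Qed.

Lemma phi_anD_eq : phi_anD beta B p = (ln E)%:E.
Proof.
apply/eqP; rewrite eq_le phi_anD_le/=; apply/lee_addgt0Pr => e e0.
have rE : E * expR (- e) < E.
  by rewrite gtr_pMr// -[ltRHS]expR0 ltr_expR oppr_lt0.
have [x x01 rx] := mf_sup_adherent beta_ge0 exp_moment rE.
have r0 : 0 < E * expR (- e) by rewrite mulr_gt0 ?expR_gt0.
have := phi_anD_ge_mass x01 r0 rx.
rewrite lnM ?posrE ?expR_gt0// expRK EFinD EFinN => H.
by rewrite -leeBlDr.
Qed.

End variational.

(** * Strict inequality *)

Section log_gap.
Context {R : realType}.

(** The defect in ln t <= t - 1; its mean at t = [w x k / E] measures the loss in Jensen's
    inequality. *)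
Definition log_gap (t : R) : R := t - 1 - ln t.

Lemma log_gap_ge0 t : 0 < t -> 0 <= log_gap t.
Proof. by move=> t0; rewrite /log_gap subr_ge0 ln_le_subr1. Qed.

Lemma log_gap_gt0 t : 0 < t -> t != 1 -> 0 < log_gap t.
Proof.
move=> t0 t1; rewrite /log_gap subr_gt0.
have l0 : ln t != 0.
  by apply: contra t1 => /eqP l0; rewrite -[t]lnK ?posrE// l0 expR0.
by have := expR_gt1Dx l0; rewrite lnK ?posrE//; lra.
Qed.

(** The gap grows away from 1 on either side; the sign condition puts t beyond a as seen from 1. *)
Lemma log_gap_le a t : 0 < a -> 0 < t -> 0 <= (t - a) * (a - 1) -> log_gap a <= log_gap t.
Proof.
move=> a0 t0 at1; rewrite /log_gap.
have := ln_le_subr1 (divr_gt0 t0 a0); rewrite ln_div ?posrE//.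
have : 0 <= (t - a) * (a - 1) / a by rewrite divr_ge0// ltW.
have -> : (t - a) * (a - 1) / a = t - a - (t / a - 1) by field; rewrite gt_eqF.
lra.
Qed.

(** Convexity: the tangent at j lies below the exponential at 0 ([h1]) and at k ([h2]), and the
    weights 1 - th and th recombine these to the value at j. *)
Lemma expR_chord (l : R) (j k : nat) (th := j%:R / k%:R : R) : (0 < k)%N ->
  (j <= k)%N -> expR (l * j%:R) <= (1 - th) + th * expR (l * k%:R).
Proof.
move=> k0 jk; set y := expR (l * j%:R).
have y0 : 0 < y by exact: expR_gt0.
have k0R : 0 < k%:R :> R by rewrite ltr0n.
have th01 : 0 <= th <= 1 by rewrite divr_ge0//= ler_pdivrMr// mul1r ler_nat.
have thk : th * k%:R = j%:R by rewrite /th divfK// gt_eqF.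
have h1 : y * (1 - l * j%:R) <= 1.
  have := expR_ge1Dx (- (l * j%:R)); rewrite expRN -/y -(ler_pM2l y0) divff ?gt_eqF//.
have h2 : y * (1 + (l * k%:R - l * j%:R)) <= expR (l * k%:R).
  have := expR_ge1Dx (l * k%:R - l * j%:R); rewrite expRD expRN -/y -(ler_pM2l y0).
  by rewrite mulrCA divff ?mulr1// gt_eqF.
have h3 := ler_wpM2l (_ : 0 <= 1 - th) h1.
have {}h3 := h3 ltac:(lra).
have h4 := ler_wpM2l (_ : 0 <= th) h2.
have {}h4 := h4 ltac:(lra).
have E : (1 - th) * (y * (1 - l * j%:R)) + th * (y * (1 + (l * k%:R - l * j%:R))) = y.
  have -> : (1 - th) * (y * (1 - l * j%:R)) + th * (y * (1 + (l * k%:R - l * j%:R))) =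
     y + y * l * (th * k%:R - j%:R) by ring.
  by rewrite thk subrr mulr0 addr0.
lra.
Qed.

Lemma wt_chord (B u v : R) (j k : nat) (th := j%:R / k%:R : R) : (0 < k)%N ->
  (j <= k)%N -> wt B u v j <= (1 - th) * (expR B + expR (- B)) + th * wt B u v k.
Proof.
move=> k0 jk; rewrite /wt !expRD.
have := ler_wpM2l (expR_ge0 B) (expR_chord u k0 jk).
have := ler_wpM2l (expR_ge0 (- B)) (expR_chord v k0 jk).
rewrite -/th; lra.
Qed.

End log_gap.

Section strictness.
Context {R : realType} {d0 : measure_display} {T : measurableType d0}
  (P0 : probability T R) (D : {RV P0 >-> nat}).
Variables beta B : R.
Hypothesis beta_gt0 : 0 < beta.
Hypothesis D_gt0 : forall w, (0 < D w)%N.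
Hypothesis exp_moment : ('E_P0[fun w => expR (beta * (D w)%:R / 2)] < +oo)%E.
Hypothesis D_nondeg : forall k, degree_law D k != 1.

Local Notation p := (degree_law D).
Local Notation h := (fun k : nat => expR (beta / 2 * k%:R)).
Local Notation E := (mf_sup D beta B).
Local Notation w x := (wt B (lamp beta x) (lamm beta x)).

Let beta_ge0 : 0 <= beta. Proof. exact: ltW. Qed.
Let E_gt0 : 0 < E. Proof. exact: mf_sup_gt0. Qed.
Let p_ge0 k : 0 <= p k. Proof. exact: degree_law_ge0. Qed.
Let p_distr : is_distr p. Proof. exact: degree_law_distr. Qed.

Lemma degree_law_finite_mean : finite_mean p.
Proof.
have b0 := beta_gt0.
have d : dominated h (fun k : nat => k%:R).
  split=> //; exists (2 / beta) => k.
  rewrite -[leLHS](_ : 2 / beta * (beta / 2 * k%:R) = _); last by field; rewrite gt_eqF.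
  rewrite ler_wpM2l ?divr_ge0// ?ltW//.
  by have := expR_ge1Dx (beta / 2 * k%:R); lra.
apply: (@le_lt_trans _ _ (\sum_(k <oo) (p k * k%:R)%:E)%E).
  rewrite [leRHS]nneseries_recl//; last by move=> k _; rewrite lee_fin mulr_ge0.
  rewrite mulr0 add0e le_eqVlt; apply/orP; left; apply/eqP.
  by apply: eq_eseriesr => k _; rewrite mulrC.
rewrite (dmeanE p_ge0 (fun k => expR_ge0 _) (exp_moment_sum exp_moment) d).
exact: ltry.
Qed.

Lemma degree_law_two_points : exists j k, [/\ (0 < j < k)%N, 0 < p j & 0 < p k].
Proof.
have [_ _ p1] := p_distr.
have nz (j : nat) : exists2 k, k != j & 0 < p k.
  apply: contrapT => H.
  have pk k : k != j -> p k = 0.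
    move=> kj; apply/eqP; rewrite eq_le p_ge0 andbT leNgt; apply/negP => pk.
    by apply: H; exists k.
  have := degree_law_sum1 D; rewrite (nneseriesD1 (n := j))//; last first.
    by move=> k _; rewrite lee_fin mulr_ge0.
  rewrite eseries0 ?adde0; last by move=> k _ /= kj; rewrite pk// mul0r.
  by rewrite mulr1 => -[/eqP]; rewrite (negbTE (D_nondeg j)).
have p0 : p 0%N = 0 by exact: degree_law0.
have [j _ pj] := nz 0%N; have [k kj pk] := nz j.
have j0 : (0 < j)%N by rewrite lt0n; apply/eqP => j0; rewrite j0 p0 ltxx in pj.
have k0 : (0 < k)%N by rewrite lt0n; apply/eqP => k0; rewrite k0 p0 ltxx in pk.
have [jk|kj'] := ltnP j k; first by exists j, k; rewrite j0 jk.
by exists k, j; rewrite k0 ltn_neqAle kj kj'.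
Qed.

(* w x is convex in the degree and below E at 0, so it cannot be close to E at
   two positive degrees; this makes Jensen's inequality uniformly strict. *)
Lemma log_gap_two_points j k : (0 < j < k)%N -> 0 < p j -> 0 < p k ->
  exists2 eta, 0 < eta &
    forall x, eta <= p j * log_gap (w x j / E) + p k * log_gap (w x k / E).
Proof.
move=> /andP[j0 jk] pj pk.
have E0 := E_gt0.
pose th : R := j%:R / k%:R.
have k0 : (0 < k)%N by lia.
have th01 : 0 < th < 1.
  by rewrite divr_gt0 ?ltr0n//= ltr_pdivrMr ?ltr0n// mul1r ltr_nat.
have l0 := lamp_half_gt0 beta_gt0.
pose de := 1 - expR (- lamp beta (1 / 2)).
have de0 : 0 < de <= 1.
  by rewrite subr_gt0 -[X in _ < X]expR0 ltr_expR oppr_lt0 l0 gerBl expR_ge0.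
have w0E : (expR B + expR (- B)) / E <= 1 - de.
  rewrite /de subKr [expR (- lamp _ _)]expRN ler_pdivrMr// [leRHS]mulrC ler_pdivlMr ?expR_gt0//.
  exact: mf_sup_ge.
(* If the normalised weight at k is below 1 + a, the chord from degree 0 puts the one at j below 1 -
   2 a + th * a, hence below 1 - a; the division by 2 leaves this margin. *)
pose a := (1 - th) * de / 2.
have a01 : 0 < a < 1 by rewrite /a; nra.
exists (Num.min (p k * log_gap (1 + a)) (p j * log_gap (1 - a))).
  by rewrite lt_min !mulr_gt0// log_gap_gt0//; first [lra|apply/eqP; lra].
move=> x.
have wE0 i : 0 < w x i / E by rewrite divr_gt0// wt_gt0.
have gj := log_gap_ge0 (wE0 j); have gk := log_gap_ge0 (wE0 k).
rewrite ge_min; apply/orP.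
have [wk|wk] := leP (1 + a) (w x k / E).
  left; rewrite ler_wpDl// ?mulr_ge0// ler_wpM2l// log_gap_le//; [lra|].
  by rewrite mulr_ge0//; lra.
right; rewrite ler_wpDr// ?mulr_ge0// ler_wpM2l// log_gap_le//; [lra|].
have ch : w x j / E <= (1 - th) * ((expR B + expR (- B)) / E) + th * (w x k / E).
  by rewrite !mulrA -mulrDl ler_pM2r ?invr_gt0//; exact: wt_chord k0 (ltnW jk).
have h1 := ler_wpM2l (_ : 0 <= 1 - th) w0E.
have {}h1 := h1 ltac:(lra).
have h2 : th * (w x k / E) <= th * (1 + a) by rewrite ler_wpM2l// ltW//; lra.
have h3 : th * a <= a by rewrite ler_piMl//; lra.
have : w x j / E <= 1 - a by rewrite /a in h2 h3 *; lra.
by move=> h4; rewrite mulr_le0//; lra.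
Qed.

(** Writing ln t = t - 1 - [log_gap t] with t = [w x k / E] leaves ln E minus a mean gap. The point
    x depends on s, so only a gap bounded below uniformly in x survives the supremum over s. *)
Lemma phi_and_lt : (phi_and beta B p < (ln E)%:E)%E.
Proof.
have [j [k [jk pj pk]]] := degree_law_two_points.
have [eta eta0 Heta] := log_gap_two_points jk pj pk.
have pm := degree_law_finite_mean.
apply: (@le_lt_trans _ _ (ln E - eta)%:E); last by rewrite lte_fin gtrBl.
rewrite /phi_and -leeBrDl// -EFinB; apply: ge_ereal_sup => _ [s s01 <-].
rewrite lee_fin lerBrDl.
have [x x01 cT] := functional_cvg beta B p_distr pm s01.
have cP := distr_sum_cvg p_distr.
have cR : ln E * (\sum_(1 <= i < n) p i) + 1 - (\sum_(1 <= i < n) p i) - eta @[n --> \oo] -->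
    ln E * 1 + 1 - 1 - eta.
  apply: cvgB; last exact: cvg_cst.
  apply: cvgB; last exact: cP.
  apply: cvgD; last exact: cvg_cst.
  by apply: cvgM; [exact: cvg_cst|exact: cP].
rewrite (_ : ln E - eta = ln E * 1 + 1 - 1 - eta); last by ring.
apply: (ler_cvg_to cT cR); near=> n.
have kn : (k < n)%N by near: n; exact: nbhs_infty_gt.
apply: (@le_trans _ _ (\sum_(1 <= i < n) p i * ln (w x i))).
  by apply: ler_sum => i _; exact: tilted_term_le.
have E0 := E_gt0.
have -> : \sum_(1 <= i < n) p i * ln (w x i) =
  ln E * (\sum_(1 <= i < n) p i) + (\sum_(1 <= i < n) p i * w x i) / E -
  \sum_(1 <= i < n) p i - \sum_(1 <= i < n) p i * log_gap (w x i / E).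
  rewrite mulr_sumr mulr_suml -big_split -!sumrB/=; apply: eq_bigr => i _.
  by rewrite /log_gap ln_div ?posrE ?wt_gt0//; ring.
have h1 : (\sum_(1 <= i < n) p i * w x i) / E <= 1.
  by rewrite ler_pdivrMr// mul1r mf_partial_le.
suff : eta <= \sum_(1 <= i < n) p i * log_gap (w x i / E) by lra.
apply: (le_trans (Heta x)).
have /andP[j0 jk'] := jk.
have g0 i : 0 <= p i * log_gap (w x i / E).
  by rewrite mulr_ge0// log_gap_ge0// divr_gt0// wt_gt0.
rewrite (bigD1_seq j)/= ?iota_uniq//; 
  last by rewrite mem_index_iota j0 (ltn_trans jk').
rewrite lerD2l big_mkcond (bigD1_seq k)/= ?iota_uniq//;
  last by rewrite mem_index_iota kn (leq_trans j0 (ltnW jk')).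
rewrite gtn_eqF// ler_wpDr// sumr_ge0// => i _.
by case: ifP.
Unshelve. all: by end_near. Qed.

End strictness.

Unset Implicit Arguments.

(** The last claim excludes the two cases of equality: for beta = 0 the degrees do not enter the
    weights, and for constant D only q = p has finite relative entropy. *)
Theorem theorem1p5 (R : realType)
  (d0 : measure_display) (T : measurableType d0) (P0 : probability T R)
  (D : {RV P0 >-> nat}) (D_gt0 : forall w, (0 < D w)%N)
  (d : measure_display) (Omega : measurableType d) (P : probability Omega R)
  (X : nat -> {RV P >-> nat}) (X_iid : iid_copies D X)
  (beta B : R) (beta_ge0 : 0 <= beta)
  (exp_moment : ('E_P0[fun w => expR (beta * (D w)%:R / 2)] < +oo)%E) :
  [/\ phi_anD beta B (degree_law D) \is a fin_num,
      annealed_pressure X beta B n @[n --> \oo] --> phi_anD beta B (degree_law D)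
    & 0 < beta -> (forall k, degree_law D k != 1) ->
      (phi_and beta B (degree_law D) < phi_anD beta B (degree_law D))%E].
Proof.
rewrite (phi_anD_eq B beta_ge0 D_gt0 exp_moment); split=> //.
- exact: pressure_cvg.
- by move=> beta_gt0 D_nondeg; exact: phi_and_lt.
Qed.
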